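(* Let $M=\varprojlim M^{i}$ be a Fréchet manifold, modeled on the Fréchet space $\mathbb{F}=\varprojlim\mathbb{E}^i$, obtained as the limit of a projective system of Banach manifolds $M^i$ modeled on Banach spaces $\mathbb{E}^i$. If $M$ is endowed with a linear connection $D$ that can be also realized as a projective limit of (linear) connections $D=\varprojlim D^{i}$, where $D^i$ is a linear connection on $M^i$, then $T^{2}M$ is a Fréchet vector bundle over $M$ with structural group $\mathcal{H}^{0}(\mathbb{F}\times\mathbb{F})$.
   Context: Projective limit manifolds. $\{M^i;\varphi^{ji}\}_{i,j\in\mathbb{N}}$ is a projective system of smooth Banach manifolds, $M^i$ modeled on the Banach space $\mathbb{E}^i$ (connecting maps $\varphi^{ji}:M^j\to M^i$ for $j\ge i$), such that (i) the models form a projective system $\{\mathbb{E}^i;\rho^{ji}\}_{i,j\in\mathbb{N}}$ with limit the Fréchet space $\mathbb{F}=\varprojlim\mathbb{E}^i$; (ii) for each $x=(x^i)\in M=\varprojlim M^i$ there exists a projective system of local charts $\{(U^i,\psi^i)\}_{i\in\mathbb{N}}$ (compatible with $\varphi^{ji}$ and $\rho^{ji}$) such that $x^i\in U^i$ and $\varprojlim U^i$ is open in $M$. Then $M$ is a Fréchet manifold modeled on $\mathbb{F}$ with charts $(\varprojlim U^i,\varprojlim\psi^i)$. Likewise $TM\cong\varprojlim TM^i$ and $T(TM)\cong\varprojlim T(TM^i)$ are Fréchet manifolds with charts given by the limits of the differentials of the $\psi^i$. Differentiability of maps between Fréchet spaces is in the sense of Leslie. Second order tangent bundle (for a Banach or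 Fréchet manifold $M$). For $x\in M$ let $C_x$ be the set of smooth curves $f:(-\varepsilon,\varepsilon)\to M$ ($\varepsilon>0$) with $f(0)=x$. Put $f'(t)=[df(t)](1)\in TM$ and $f''(t)=[df'(t)](1)\in T(TM)$, and define $f\approx_x g$ if and only if $f'(0)=g'(0)$ and $f''(0)=g''(0)$. Then $T_x^2M=C_x/\approx_x$ and $T^2M=\bigcup_{x\in M}T^2_xM$, with natural projection $\pi_2:T^2M\to M$ sending the class $[f,x]_2$ of $f$ to $x$. Connections. On a manifold $N$ modeled on $\mathbb{E}$ with atlas $\{(U_\alpha,\psi_\alpha)\}$ and induced charts $\Psi_\alpha$ of $TN$ and $\widetilde\Psi_\alpha$ of $T(TN)$, a connection (in the sense of Vilms) is a vector bundle morphism $D:T(TN)\to TN$ whose local forms $D_\alpha=\Psi_\alpha\circ D\circ\widetilde\Psi_\alpha^{-1}$ are $D_\alpha(y,u,v,w)=(y,w+\omega_\alpha(y,u)\cdot v)$ with $\omega_\alpha:\psi_\alpha(U_\alpha)\times\mathbb{E}\to\mathcal{L}(\mathbb{E},\mathbb{E})$ smooth. It is linear if each $\omega_\alpha$ is linear in its second variable, and then it is characterized by its Christoffel symbols $\Gamma_\alpha:\psi_\alpha(U_\alpha)\to\mathcal{L}(\mathbb{E},\mathcal{L}(\mathbb{E},\mathbb{E}))$, $\Gamma_\alpha(y)[u]=\omega_\alpha(y,u)$. For $M=\varprojlim M^i$, $D=\varprojlim D^i$ means that the connections $D^i:T(TM^i)\to TM^i$ form a projective system of maps whose limit is $D:T(TM)\cong\varprojlim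 T(TM^i)\to\varprojlim TM^i\cong TM$. The group $\mathcal{H}^0(\mathbb{F}\times\mathbb{F})$. Define $$\mathcal{H}^{0}(\mathbb{F}\times\mathbb{F})=\Big\{(l^i)_{i\in\mathbb{N}}\in\prod_{i=1}^\infty GL(\mathbb{E}^i\times\mathbb{E}^i):\ \varprojlim l^i\ \text{exists}\Big\},$$ i.e. the $l^i$ commute with the connecting maps $\rho^{ji}\times\rho^{ji}$. It is a topological group, isomorphic to the projective limit of the Banach–Lie groups $\mathcal{H}^0_i(\mathbb{F}\times\mathbb{F})$ consisting of the tuples $(l^1,\dots,l^i)\in\prod_{k=1}^iGL(\mathbb{E}^k\times\mathbb{E}^k)$ with $(\rho^{jk}\times\rho^{jk})\circ l^j=l^k\circ(\rho^{jk}\times\rho^{jk})$ for $k\le j\le i$. It is considered as a generalized Lie group via its embedding $\epsilon:\mathcal{H}^0(\mathbb{F}\times\mathbb{F})\to\mathcal{L}(\mathbb{F}\times\mathbb{F})$, $(l^i)\mapsto\varprojlim l^i$, into the topological vector space of continuous linear endomorphisms of $\mathbb{F}\times\mathbb{F}$. A Fréchet vector bundle over $M$ with structural group $\mathcal{H}^0(\mathbb{F}\times\mathbb{F})$ is a vector bundle with fibers of type $\mathbb{F}\times\mathbb{F}$ whose transition functions $T_{\alpha\beta}$ take values in $\mathcal{H}^0(\mathbb{F}\times\mathbb{F})$, i.e. $T_{\alpha\beta}=\epsilon\circ T^*_{\alpha\beta}$ with $T^*_{\alpha\beta}:U_\alpha\cap U_\beta\to\mathcal{H}^0(\mathbb{F}\times\mathbb{F})$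 smooth. *)

(* Defs.v *)
From HB Require Import structures.
From mathcomp Require Import all_boot all_order all_algebra.
From mathcomp Require Import all_classical all_reals all_analysis.

Set Implicit Arguments.
Unset Strict Implicit.
Unset Printing Implicit Defensive.

Import Order.TTheory GRing.Theory Num.Theory.
Import numFieldNormedType.Exports.

Local Open Scope classical_set_scope.
Local Open Scope ring_scope.

Section ContinuousLinear.
Context {R : realType}.

(* von Neumann boundedness: every neighbourhood of 0 absorbs [B]. *)
Definition vbounded (E : tvsType R) (B : set E) : Prop :=
  forall U : set E, nbhs 0 U ->
    \forall t \near (0 : R), forall x, B x -> U (t *: x).

Lemma vboundedU (E : tvsType R) (A B : set E) :
  vbounded A -> vbounded B -> vbounded (A `|` B).
Proof.
move=> bA bB U U0; near=> t => x [Ax|Bx].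
- by move: x Ax; near: t; exact: bA.
- by move: x Bx; near: t; exact: bB.
Unshelve. all: by end_near. Qed.

Variables E F : tvsType R.

Definition clin_pred : {pred E -> F} :=
  mem [set f : E -> F | linear f /\ continuous f].

Lemma clin_submod_closed : submod_closed clin_pred.
Proof.
split.
  rewrite inE /=; split.
    by move=> a x y; rewrite -[RHS]/(a *: 0 + 0) scaler0 addr0.
  by move=> x; exact: cvg_cst.
move=> a f g; rewrite !inE => -[fl fc] [gl gc]; split.
  move=> b x y; rewrite -[LHS]/(a *: f (b *: x + y) + g (b *: x + y))
    -[RHS]/(b *: (a *: f x + g x) + (a *: f y + g y)) fl gl.
  rewrite !scalerDr !scalerA (mulrC a b) !addrA.
  by congr (_ + _); rewrite -!addrA; congr (_ + _); rewrite addrC.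
move=> x.
apply: (@continuous2_cvg _ _ _ _ _ _ (fun y => a *: f y) g
  (fun u v : F => u + v) (a *: f x) (g x)).
- exact: (@add_continuous F (a *: f x, g x)).
- apply: (@continuous2_cvg _ _ _ _ _ _ (fun=> a : R^o) f
    (fun (u : R^o) (v : F) => u *: v) a (f x)).
  + exact: (@scale_continuous R F (a, f x)).
  + exact: cvg_cst.
  + exact: fc.
- exact: gc.
Qed.

HB.instance Definition _ :=
  GRing.isSubmodClosed.Build R (E -> F) clin_pred clin_submod_closed.

Record clin := CLin { clin_fun :> E -> F ; clinP : clin_fun \in clin_pred }.

HB.instance Definition _ := [isSub for clin_fun].
HB.instance Definition _ := [Choice of clin by <:].
HB.instance Definition _ := [SubChoice_isSubLmodule of clin by <:].

(* The neighbourhoods of [l] are generated by the sets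
   [{m | (m - l)(B) is contained in U}], with [B] bounded and [U] a
   neighbourhood of 0; between normed spaces this is the topology of the
   operator norm. *)
Definition clin_open (A : set clin) : Prop :=
  forall l, A l -> exists B : set E, exists U : set F,
    [/\ vbounded B, nbhs 0 U &
      forall m : clin, (forall x, B x -> U (m x - l x)) -> A m].

Lemma clin_openT : clin_open setT.
Proof.
move=> l _; exists set0, setT; split=> //; last exact: filterT.
by move=> U U0; near=> t => x.
Unshelve. all: by end_near. Qed.

Lemma clin_openI : setI_closed clin_open.
Proof.
move=> A1 A2 o1 o2 l [/o1[B1 [U1 [b1 n1 s1]]] /o2[B2 [U2 [b2 n2 s2]]]].
exists (B1 `|` B2), (U1 `&` U2); split; first exact: vboundedU.
  exact: filterI.
move=> m h; split; first by apply: s1 => x Bx; have [] := h x (or_introl Bx).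
by apply: s2 => x Bx; have [] := h x (or_intror Bx).
Qed.

Lemma clin_open_bigU (I : Type) (A : I -> set clin) :
  (forall i, clin_open (A i)) -> clin_open (\bigcup_i A i).
Proof.
move=> oA l [i _ /oA[B [U [bB nU s]]]].
by exists B, U; split=> // m /s Am; exists i.
Qed.

HB.instance Definition _ :=
  isOpenTopological.Build clin clin_openT clin_openI clin_open_bigU.

End ContinuousLinear.

Arguments clin {R} E F.

Definition invertible {R : realType} {E : tvsType R} (l : clin E E) : Prop :=
  exists m : clin E E, cancel l m /\ cancel m l.

Section Leslie.
Context {R : realType}.

Definition leslie_remainder {E : tvsType R} {G : preTopologicalLmodType R}
    (f : E -> G) (x : E) (L : E -> G) (p : R^o * E) : G :=
  if p.1 == 0 then 0
  else p.1^-1 *: (f (x + p.1 *: p.2) - f x - L (p.1 *: p.2)).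

Definition is_leslie_derivative {E : tvsType R} {G : preTopologicalLmodType R}
    (f : E -> G) (x : E) (L : E -> G) : Prop :=
  [/\ linear L, continuous L &
      forall v : E, {for (0, v), continuous (leslie_remainder f x L)}].

Definition leslie_differentiable {E : tvsType R}
    {G : preTopologicalLmodType R} (f : E -> G) (x : E) : Prop :=
  exists L, is_leslie_derivative f x L.

(* The derivative [Df(x)], with junk value 0 if [f] is not differentiable at
   [x]; it depends only on the germ of [f] at [x]. *)
Definition Df {E : tvsType R} {G : preTopologicalLmodType R}
    (f : E -> G) (x : E) : E -> G :=
  xget 0 [set L | is_leslie_derivative f x L].

(* [f] is of class [C^n] on the open set [U]; for n > 0, [Df] is required to be
   of class [C^(n-1)] jointly, as the map [U * E -> G, (x, v) |-> Df(x)v]. *)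
Fixpoint class_C (n : nat) {E : tvsType R} {G : preTopologicalLmodType R}
    (U : set E) (f : E -> G) : Prop :=
  (forall x, U x -> {for x, continuous f}) /\
  match n with
  | 0 => True
  | n'.+1 => (forall x, U x -> leslie_differentiable f x) /\
             class_C n' (U `*` [set: E]) (fun p => Df f p.1 p.2)
  end.

Definition smooth {E : tvsType R} {G : preTopologicalLmodType R}
    (U : set E) (f : E -> G) : Prop := forall n, class_C n U f.

End Leslie.

(* A set of points with a family of charts to the model space [E].  As in
   Lang, the topology is not part of the data: it is the one that makes the
   charts homeomorphisms ([mopen] below).  The points form a subset [carrier]
   of a type, and [coord a] is only meaningful on [dom a]. *)
Record atlas {R : realType} (E : tvsType R) := Atlas {
  pt : Type ;
  carrier : set pt ;
  chart : Type ;
  dom : chart -> set pt ;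
  coord : chart -> pt -> E }.

Arguments pt {R E} M : rename.
Arguments carrier {R E} M _ : rename.
Arguments chart {R E} M : rename.
Arguments dom {R E} M a _ : rename.
Arguments coord {R E} M a _ : rename.

(* [g] read in the chart [a], i.e. [g \o (coord M a)^-1], extended by 0. *)
Definition in_chart {R : realType} {E : tvsType R} (M : atlas E) (a : chart M)
    {G : preTopologicalLmodType R} (g : pt M -> G) (y : E) : G :=
  xget 0 (g @` (dom M a `&` coord M a @^-1` [set y])).

Definition transition {R : realType} {E : tvsType R} (M : atlas E)
    (a b : chart M) : E -> E :=
  in_chart a (coord M b).

Definition is_manifold {R : realType} {E : tvsType R} (M : atlas E) : Prop :=
  (forall a, dom M a `<=` carrier M) /\
  (forall x, carrier M x -> exists a, dom M a x) /\
  (forall a x y, dom M a x -> dom M a y ->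
     coord M a x = coord M a y -> x = y) /\
  (forall a b, open (coord M a @` (dom M a `&` dom M b)) /\
     smooth (coord M a @` (dom M a `&` dom M b)) (transition a b)).

Definition mopen {R : realType} {E : tvsType R} (M : atlas E)
    (A : set (pt M)) : Prop :=
  A `<=` carrier M /\ forall a, open (coord M a @` (A `&` dom M a)).

Arguments mopen {R E} M A.

(* Smoothness of [g : A -> N] on an open set [A] of [M]; the openness
   condition expresses the continuity of [g]. *)
Definition msmooth {R : realType} {E E' : tvsType R} (M : atlas E)
    (N : atlas E') (A : set (pt M)) (g : pt M -> pt N) : Prop :=
  (forall x, A x -> carrier N (g x)) /\
  forall a b, let V := coord M a @` (A `&` dom M a `&` g @^-1` dom N b) in
    open V /\ smooth V (in_chart a (coord N b \o g)).

Arguments msmooth {R E E'} M N A g.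

Definition msmooth_vect {R : realType} {E : tvsType R} (M : atlas E)
    {G : preTopologicalLmodType R} (A : set (pt M)) (g : pt M -> G) : Prop :=
  forall a, smooth (coord M a @` (A `&` dom M a)) (in_chart a g).

Arguments msmooth_vect {R E} M {G} A g.

Definition prod_atlas {R : realType} {E : tvsType R} (M : atlas E)
    (G : tvsType R) : atlas (E * G)%type :=
  @Atlas R (E * G)%type (pt M * G)%type (carrier M `*` setT) (chart M)
    (fun a => dom M a `*` setT) (fun a p => (coord M a p.1, p.2)).

(* A tangent vector at [x] is the family of its principal parts in the charts
   at [x] (and 0 in the other charts); the parts are related by the
   derivatives of the transition maps. *)
Definition tangent {R : realType} {E : tvsType R} (M : atlas E)
    : atlas (E * E)%type :=
  let TM := [set xi : pt M * (chart M -> E) |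
    [/\ carrier M xi.1,
        forall a, ~ dom M a xi.1 -> xi.2 a = 0 &
        forall a b, dom M a xi.1 -> dom M b xi.1 ->
          xi.2 b = Df (transition a b) (coord M a xi.1) (xi.2 a)]] in
  @Atlas R (E * E)%type (pt M * (chart M -> E))%type TM (chart M)
    (fun a => TM `&` [set xi | dom M a xi.1])
    (fun a xi => (coord M a xi.1, xi.2 a)).

(* The differential [Tg : TM -> TN]; its principal part in [b] does not depend
   on the chart [a] used at the source. *)
Definition tangent_map {R : realType} {E E' : tvsType R} (M : atlas E)
    (N : atlas E') (g : pt M -> pt N) (xi : pt (tangent M)) : pt (tangent N) :=
  (g xi.1,
   fun b => xget 0 [set w | dom N b (g xi.1) /\ exists2 a, dom M a xi.1 &
     w = Df (in_chart a (coord N b \o g)) (coord M a xi.1) (xi.2 a)]).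

Arguments tangent_map {R E E'} M N g xi.

(* [f'(t) = [df(t)](1)] *)
Definition velocity {R : realType} {E : tvsType R} (M : atlas E)
    (f : R^o -> pt M) (t : R^o) : pt (tangent M) :=
  (f t, fun a => if `[< dom M a (f t) >] then Df (coord M a \o f) t 1 else 0).

Arguments velocity {R E} M f t.

(* [f''(t) = [df'(t)](1)] *)
Definition acceleration {R : realType} {E : tvsType R} (M : atlas E)
    (f : R^o -> pt M) : R^o -> pt (tangent (tangent M)) :=
  velocity (tangent M) (velocity M f).

Arguments acceleration {R E} M f t.

Definition smooth_curve {R : realType} {E : tvsType R} (M : atlas E) (e : R)
    (f : R^o -> pt M) : Prop :=
  let I := [set t : R^o | `|t| < e] in
  (forall t, I t -> carrier M (f t)) /\
  forall a, let V := I `&` f @^-1` dom M a in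
    open V /\ smooth V (coord M a \o f).

Arguments smooth_curve {R E} M e f.

(* The set [C_x]; a curve on [(-e, e)] is represented by any of its extensions
   to the whole line. *)
Definition curves_at {R : realType} {E : tvsType R} (M : atlas E) (x : pt M) :
    set (R^o -> pt M) :=
  [set f | f 0 = x /\ exists2 e : R, 0 < e & smooth_curve M e f].

Arguments curves_at {R E} M x _.

Definition equiv2 {R : realType} {E : tvsType R} (M : atlas E)
    (f g : R^o -> pt M) : Prop :=
  velocity M f 0 = velocity M g 0 /\ acceleration M f 0 = acceleration M g 0.

Arguments equiv2 {R E} M f g.

(* [T^2 M]: the points are the pairs [(x, [f,x]_2)], the class being a set of
   curves.  It carries its usual smooth structure, with coordinates
   [(psi(x), (psi f)'(0), (psi f)''(0))]; the last two are the principal part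
   of [f''(0)] in the chart [psi]. *)
Definition T2 {R : realType} {E : tvsType R} (M : atlas E)
    : atlas (E * (E * E))%type :=
  let T2M := [set k : pt M * set (R^o -> pt M) | carrier M k.1 /\
    exists2 f, curves_at M k.1 f &
      k.2 = [set g | curves_at M k.1 g /\ equiv2 M f g]] in
  @Atlas R (E * (E * E))%type (pt M * set (R^o -> pt M))%type T2M (chart M)
    (fun a => T2M `&` [set k | dom M a k.1])
    (fun a k => (coord M a k.1,
                 xget 0 [set (acceleration M f 0).2 a | f in k.2])).

Definition pi2 {R : realType} {E : tvsType R} (M : atlas E) :
    pt (T2 M) -> pt M := fst.

Arguments pi2 {R E} M _.

(* [D : T(TM) -> TM] has local forms [(y,u,v,w) |-> (y, w + omega(y,u) v)];
   such a map is fibrewise linear over the projection [TM -> M]. *)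
Definition is_connection {R : realType} {E : tvsType R} (M : atlas E)
    (D : pt (tangent (tangent M)) -> pt (tangent M))
    (omega : chart M -> E * E -> clin E E) : Prop :=
  forall a : chart M,
    smooth ((coord M a @` dom M a) `*` [set: E]) (omega a) /\
    forall xi, dom (tangent (tangent M)) a xi ->
      dom (tangent M) a (D xi) /\
      let: ((y, u), (v, w)) := coord (tangent (tangent M)) a xi in
      coord (tangent M) a (D xi) = (y, w + omega a (y, u) v).

Arguments is_connection {R E} M D omega.

Definition is_linear_connection {R : realType} {E : tvsType R} (M : atlas E)
    (D : pt (tangent (tangent M)) -> pt (tangent M)) : Prop :=
  exists2 omega : chart M -> E * E -> clin E E, is_connection M D omega &
    forall a y, (coord M a @` dom M a) y -> linear (fun u => omega a (y, u)).

Arguments is_linear_connection {R E} M D.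

(* [Phi] is the fibre component of a trivialization over [W]; it is smooth, with
   smooth inverse, for the given smooth structure of the total space [P]. *)
Definition is_trivialization {R : realType} (F G X : tvsType R) (M : atlas F)
    (P : atlas X)
    (pr : pt P -> pt M) (W : set (pt M)) (Phi : pt P -> G) : Prop :=
  let P_W := carrier P `&` pr @^-1` W in
  let tau := fun xi => (pr xi, Phi xi) in
  mopen M W /\ msmooth P (prod_atlas M G) P_W tau /\
  exists s : pt (prod_atlas M G) -> pt P,
    [/\ msmooth (prod_atlas M G) P (W `*` setT) s,
        forall z, W z.1 -> P_W (s z),
        forall xi, P_W xi -> s (tau xi) = xi &
        forall z, W z.1 -> tau (s z) = z].

Arguments is_trivialization {R F G X} M P pr W Phi.

Section ProjectiveLimits.
Context {R : realType} (E : nat -> completeNormedModType R)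
  (rho : forall j i, E j -> E i).

(* Connecting maps [rho j i] and [phi j i] matter only for [i <= j]. *)
Definition proj_system : Prop :=
  [/\ forall i j, (i <= j)%N -> linear (@rho j i) /\ continuous (@rho j i),
      forall i x, @rho i i x = x &
      forall i j k x, (i <= j <= k)%N ->
        @rho j i (@rho k j x) = @rho k i x].

(* [F = lim E^i] with canonical projections [prj]; since the system is
   directed, the sets [prj i @^-1` B] form a basis of the limit topology. *)
Definition is_proj_limit (F : tvsType R) (prj : forall i, F -> E i) : Prop :=
  (forall i, linear (prj i) /\ continuous (prj i)) /\
  (forall i j x, (i <= j)%N -> @rho j i (prj j x) = prj i x) /\
  (forall x y, (forall i, prj i x = prj i y) -> x = y) /\
  (forall t : (forall i, E i),
     (forall i j, (i <= j)%N -> @rho j i (t j) = t i) ->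
     exists x, forall i, prj i x = t i) /\
  (forall x A, nbhs x A ->
     exists i, exists2 B, nbhs (prj i x) B & prj i @^-1` B `<=` A).

Variables (Ms : forall i, atlas (E i))
  (phi : forall j i, pt (Ms j) -> pt (Ms i)).

Definition manifold_proj_system : Prop :=
  [/\ forall i, is_manifold (Ms i),
      forall i j, (i <= j)%N ->
        msmooth (Ms j) (Ms i) (carrier (Ms j)) (@phi j i),
      forall i x, carrier (Ms i) x -> @phi i i x = x &
      forall i j k x, (i <= j <= k)%N -> carrier (Ms k) x ->
        @phi j i (@phi k j x) = @phi k i x].

Definition chart_proj_system (a : forall i, chart (Ms i)) : Prop :=
  forall i j x, (i <= j)%N -> dom (Ms j) (a j) x ->
    dom (Ms i) (a i) (@phi j i x) /\
    coord (Ms i) (a i) (@phi j i x) = @rho j i (coord (Ms j) (a j) x).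

(* [M = lim M^i], with projections [p], as a set and as a topological space,
   is a manifold modeled on [F = lim E^i] whose charts are limits of
   projective systems of charts; [is_manifold M] contains that these charts
   cover [M] and have open images in [F]. *)
Definition is_manifold_limit (F : tvsType R) (prj : forall i, F -> E i)
    (M : atlas F) (p : forall i, pt M -> pt (Ms i)) : Prop :=
  is_manifold M /\
  (forall i x, carrier M x -> carrier (Ms i) (p i x)) /\
  (forall i j x, (i <= j)%N -> carrier M x -> @phi j i (p j x) = p i x) /\
  (forall x y, carrier M x -> carrier M y ->
     (forall i, p i x = p i y) -> x = y) /\
  (forall t : (forall i, pt (Ms i)),
     (forall i, carrier (Ms i) (t i)) ->
     (forall i j, (i <= j)%N -> @phi j i (t j) = t i) ->
     exists2 x, carrier M x & forall i, p i x = t i) /\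
  (forall A, A `<=` carrier M ->
     (mopen M A <-> forall x, A x -> exists i, exists O : set (pt (Ms i)),
        [/\ mopen (Ms i) O, O (p i x) & carrier M `&` p i @^-1` O `<=` A])) /\
  (forall b : chart M, exists a : (forall i, chart (Ms i)),
     [/\ chart_proj_system a,
         dom M b =
           carrier M `&` [set x | forall i, dom (Ms i) (a i) (p i x)] &
         forall i x, dom M b x ->
           prj i (coord M b x) = coord (Ms i) (a i) (p i x)]).

(* [D = lim D^i], through [T(TM) = lim T(TM^i)] and [TM = lim TM^i]. *)
Definition connection_limit (F : tvsType R) (M : atlas F)
    (p : forall i, pt M -> pt (Ms i))
    (Ds : forall i, pt (tangent (tangent (Ms i))) -> pt (tangent (Ms i)))
    (D : pt (tangent (tangent M)) -> pt (tangent M)) : Prop :=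
  (forall i j xi, (i <= j)%N -> carrier (tangent (tangent (Ms j))) xi ->
     tangent_map (Ms j) (Ms i) (@phi j i) (Ds j xi) =
     Ds i (tangent_map (tangent (Ms j)) (tangent (Ms i))
             (tangent_map (Ms j) (Ms i) (@phi j i)) xi)) /\
  (forall i xi, carrier (tangent (tangent M)) xi ->
     tangent_map M (Ms i) (p i) (D xi) =
     Ds i (tangent_map (tangent M) (tangent (Ms i))
             (tangent_map M (Ms i) (p i)) xi)).

Definition H0 (l : forall i, clin (E i * E i)%type (E i * E i)%type) : Prop :=
  (forall i, invertible (l i)) /\
  forall i j z, (i <= j)%N ->
    (@rho j i (l j z).1, @rho j i (l j z).2) =
    l i (@rho j i z.1, @rho j i z.2).

(* [T = epsilon(l)], i.e. [T] is the limit of the [l i]. *)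
Definition is_epsilon (F : tvsType R) (prj : forall i, F -> E i)
    (l : forall i, clin (E i * E i)%type (E i * E i)%type)
    (T : clin (F * F)%type (F * F)%type) : Prop :=
  forall i z, (prj i (T z).1, prj i (T z).2) = l i (prj i z.1, prj i z.2).

(* Smoothness of [Tstar] with values in [H^0] is required both componentwise
   (in the limit of the Banach-Lie groups, i.e. in the product of the
   [L(E^i * E^i)]) and after the embedding [epsilon] in [L(F * F)]. *)
Definition is_vector_bundle_H0 (F X : tvsType R) (prj : forall i, F -> E i)
    (M : atlas F) (P : atlas X) (pr : pt P -> pt M) : Prop :=
  is_manifold P /\ msmooth P M (carrier P) pr /\
  exists (B : Type) (W : B -> set (pt M)) (Phi : B -> pt P -> (F * F)%type),
    [/\ forall x, carrier M x -> exists b, W b x,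
        forall b, is_trivialization M P pr (W b) (Phi b) &
        forall b c,
          exists (Tstar : pt M ->
                    forall i, clin (E i * E i)%type (E i * E i)%type)
                 (T : pt M -> clin (F * F)%type (F * F)%type),
          [/\ forall x, (W b `&` W c) x -> H0 (Tstar x),
              forall x, (W b `&` W c) x -> is_epsilon prj (Tstar x) (T x),
              forall xi, carrier P xi -> (W b `&` W c) (pr xi) ->
                Phi b xi = T (pr xi) (Phi c xi),
              forall i, msmooth_vect M (W b `&` W c) (fun x => Tstar x i) &
              msmooth_vect M (W b `&` W c) T]].

End ProjectiveLimits.

Arguments is_vector_bundle_H0 {R E} rho {F X} prj M P pr.

(* Main.v *)
(* Let [[f, x]_2] be a point of [T^2 M] and [b] a chart at [x].  By the local form
   of [D], the principal part of [D (f''(0))] in [b] is [w + omega_b(y, u) u],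
   where [(u, w)] are the first two derivatives of [f] at 0 read in [b].  The pair
   [(u, w + omega_b(y, u) u)] is therefore the principal part of the two tangent
   vectors [f'(0)] and [D (f''(0))] at [x], and under a change of charts with
   transition map [sigma] it is transformed by [Dsigma(y) x Dsigma(y)].  On a
   projective limit of charts this operator is the limit of the corresponding
   operators on the [E^i * E^i].

   Two points need care in Frechet spaces.  Evaluation [L(F, F) * F -> F] is not
   continuous, but it is along sequences (a convergent sequence is bounded), and [F]
   is first countable; so [(y, u) |-> omega_b(y, u) u] is smooth.  Conversely, if
   [g(x, v)] is jointly smooth and linear in [v], then [x |-> g(x, .)] is smooth
   into [L(E, G)] with the topology of bounded convergence, by the mean value
   theorem in locally convex spaces; so [y |-> Dsigma(y)] is smooth. *)
From HB Require Import structures.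
From mathcomp Require Import all_boot all_order all_algebra.
From mathcomp Require Import all_classical all_reals all_analysis.
From mathcomp Require Import ring.
(* Imported last: [vector.coord] would shadow [Defs.coord]. *)
Require Import Defs.

Set Implicit Arguments.
Unset Strict Implicit.
Unset Printing Implicit Defensive.

Import Order.TTheory GRing.Theory Num.Theory.
Import numFieldNormedType.Exports.

Local Open Scope classical_set_scope.
Local Open Scope ring_scope.

(* Where a tvsType is expected, [(G * H)%type] is elaborated with a
   [reverse_coercion], which gets in the way of unification. *)
Local Notation tprod G H := (Datatypes_prod__canonical__tvs_Tvs G H)
  (only parsing).

(** A [tvsType] need be neither Hausdorff nor first countable. Both properties are carried as
    classes, [separated_tlm] for the uniqueness of derivatives and [first_countable] for evaluation;
    they pass to products and reach [F] from the normed spaces [E i] through the projections. Maps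
    with values in [clin] are differentiated too, and [clin] is made a topological module only, so
    uniqueness of derivatives and the lemmas built on it take a [topologicalLmodType] as target.
    Since [Df] is a choice and [class_C] iterates it on a domain that doubles at each order,
    composition, evaluation and currying are handled by exhibiting an explicit derivative made of
    maps of the same kind, in an induction over all spaces. In the natural coordinates of [T2 M], a
    change of charts adds to [w] the term [D^2 sigma(y)(u, u)], quadratic in [u]: these coordinates
    alone give no vector bundle, and the term in [omega] absorbs the defect. The second derivative
    is never expanded; the absorption is read off the compatibility condition in the definition of
    [tangent]. *)

Section LinearFacts.
Context {R : realType} {V W : lmodType R} {L : V -> W}.
Hypothesis linL : linear L.

Lemma lin0 : L 0 = 0.
Proof. by have := linL (-1) 0 0; rewrite scaleN1r oppr0 addr0 scaleN1r addNr.
  Qed.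

Lemma linD x y : L (x + y) = L x + L y.
Proof. by have := linL 1 x y; rewrite !scale1r. Qed.

Lemma linZ a x : L (a *: x) = a *: L x.
Proof. by have := linL a x 0; rewrite !addr0 lin0 addr0. Qed.

End LinearFacts.

Lemma nbhs_cvg_pair {T : Type} {F : set_system T} {FF : Filter F}
    {U V : topologicalType} (f : T -> U) (g : T -> V) (a : U) (b : V) :
  f @ F --> a -> g @ F --> b -> (fun x => (f x, g x)) @ F --> (a, b).
Proof. exact: (@cvg_pair _ _ _ F (nbhs a) (nbhs b)). Qed.

Lemma nbhs_cvg_fst {U V : topologicalType} (a : U) (b : V) :
  (fun p : U * V => p.1) @ nbhs (a, b) --> a.
Proof. exact: (@cvg_fst _ _ (nbhs a) (nbhs b)). Qed.

Lemma nbhs_cvg_snd {U V : topologicalType} (a : U) (b : V) :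
  (fun p : U * V => p.2) @ nbhs (a, b) --> b.
Proof. exact: (@cvg_snd _ _ (nbhs a) (nbhs b)). Qed.

(** * Leslie derivatives in topological modules *)

Section TopologicalModules.
Context {R : realType}.

(** Hausdorffness, tested at 0. *)
Class separated_tlm (G : preTopologicalLmodType R) : Prop :=
  separated_tlmP : forall x : G, (forall U, nbhs 0 U -> U x) -> x = 0.

Lemma tlm_cvgD {T : Type} {F : set_system T} {FF : Filter F}
    (G : topologicalLmodType R) (f g : T -> G) (a b : G) :
  f @ F --> a -> g @ F --> b -> (fun x => f x + g x) @ F --> a + b.
Proof.
exact: (@continuous2_cvg _ _ _ _ _ _ f g
  (fun u v : G => u + v) a b (@add_continuous G (a, b))).
Qed.

Lemma tlm_cvgZ {T : Type} {F : set_system T} {FF : Filter F}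
    (G : topologicalLmodType R) (f : T -> R^o) (g : T -> G) (a : R^o) (b : G) :
  f @ F --> a -> g @ F --> b -> (fun x => f x *: g x) @ F --> a *: b.
Proof.
exact: (@continuous2_cvg _ _ _ _ _ _ f g
  (fun (u : R^o) (v : G) => u *: v) a b (@scale_continuous R G (a, b))).
Qed.

Lemma tlm_cvgB {T : Type} {F : set_system T} {FF : Filter F}
    (G : topologicalLmodType R) (f g : T -> G) (a b : G) :
  f @ F --> a -> g @ F --> b -> (fun x => f x - g x) @ F --> a - b.
Proof.
move=> fa gb; apply: tlm_cvgD => //.
exact: (cvg_comp _ _ gb (@opp_continuous G b)).
Qed.

Lemma separated_cvg_unique {T : Type} {F : set_system T} {FF : ProperFilter F}
    (G : topologicalLmodType R) (f : T -> G) (a b : G) :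
  separated_tlm G -> f @ F --> a -> f @ F --> b -> a = b.
Proof.
move=> sepG fa fb; apply/eqP; rewrite -subr_eq0; apply/eqP.
apply: sepG => U U0.
have : (fun x => f x - f x) @ F --> a - b by exact: tlm_cvgB.
have -> : (fun x => f x - f x) = (fun=> 0) by apply/funext => x; rewrite subrr.
(* [U] is reflected into a neighbourhood of [a - b]; the constant 0 converges to [a - b], so it lies
   in the reflected set, which says [U (a - b)]. *)
move=> h; have /h : nbhs (a - b) [set z | U (a - b - z)].
  have : (fun z : G => a - b - z) @ nbhs (a - b) --> a - b - (a - b).
    by apply: tlm_cvgB; [exact: cvg_cst|exact: cvg_id].
  by rewrite subrr; apply.
by move=> hU; have [x /=] := @filter_ex _ F FF _ hU; rewrite subr0.
Qed.

(* The difference quotient is written without dividing by [t] and only needs to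
   hold near [x], which makes invariance under change of germ and the chain
   rule immediate; see [leslieP]. *)
Definition is_lder {E : tvsType R} {G : preTopologicalLmodType R}
    (f : E -> G) (x : E) (L : E -> G) : Prop :=
  [/\ linear L, continuous L &
    exists2 r : R^o * E -> G, (forall v : E, r @ nbhs ((0 : R^o), v) --> (0 :
      G)) &
      forall v : E, \forall p \near ((0 : R^o), v),
        f (x + p.1 *: p.2) = f x + p.1 *: (L p.2 + r p)].

Lemma leslieP {E : tvsType R} {G : preTopologicalLmodType R}
    (f : E -> G) (x : E) (L : E -> G) :
  is_leslie_derivative f x L <-> is_lder f x L.
Proof.
split=> -[linL cL H]; split => //.
  exists (leslie_remainder f x L).
    move=> v; have : leslie_remainder f x L @ nbhs ((0 : R^o), v) -->
      leslie_remainder f x L ((0 : R^o), v) by exact: H.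
    by rewrite {2}/leslie_remainder /= eqxx.
  move=> v; apply: filterE => -[t w]; rewrite /leslie_remainder /=.
  case: eqP => [->|/eqP t0]; first by rewrite !scale0r !addr0.
  rewrite scalerDr scalerA divff// scale1r (linZ linL).
  by rewrite [X in _ = _ + X]addrC subrK [RHS]addrC subrK.
case: H => r r0 H => v; change (leslie_remainder f x L @ nbhs ((0 : R^o), v) -->
      leslie_remainder f x L ((0 : R^o), v)).
rewrite {2}/leslie_remainder /= eqxx => U U0.
have rU := r0 v U U0; have Hv := H v.
change (\forall p \near ((0 : R^o), v), U (leslie_remainder f x L p)).
near=> p; rewrite /leslie_remainder; case: eqP => [_|/eqP p0].
  exact: nbhs_singleton.
have -> : f (x + p.1 *: p.2) = f x + p.1 *: (L p.2 + r p) by near: p.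
rewrite [f x + _]addrC addrK (linZ linL) -scalerBr [L p.2 + _]addrC addrK.
by rewrite scalerA mulVf// scale1r; near: p.
Unshelve. all: by end_near. Qed.

Lemma lderDf {E : tvsType R} {G : preTopologicalLmodType R}
    (f : E -> G) (x : E) :
  leslie_differentiable f x -> is_lder f x (Df f x).
Proof. by move=> h; apply/leslieP; exact: (xgetPex 0 h). Qed.

(** Transports what holds near [x] to the pairs (scalar, direction) near [(0, v)], where the
    remainder of Leslie lives. *)
Lemma ray_cvg {E : tvsType R} (x v : E) :
  (fun p : R^o * E => x + p.1 *: p.2) @ nbhs ((0 : R^o), v) --> x.
Proof.
rewrite -[X in _ --> X]addr0 -[X in _ + X](scale0r v).
apply: tlm_cvgD; first exact: cvg_cst.
by apply: tlm_cvgZ; [exact: nbhs_cvg_fst|exact: nbhs_cvg_snd].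
Qed.

Lemma lder_ext {E : tvsType R} {G : preTopologicalLmodType R}
    (f g : E -> G) (x : E) (L : E -> G) :
  (\forall y \near x, f y = g y) -> is_lder f x L -> is_lder g x L.
Proof.
move=> fg [linL cL [r r0 fr]]; split => //; exists r => // v.
have /= fg' := @ray_cvg E x v _ fg.
have h := fr v; near=> p.
rewrite -(nbhs_singleton fg).
have <- : f (x + p.1 *: p.2) = g (x + p.1 *: p.2) by near: p.
by near: p.
Unshelve. all: by end_near. Qed.

(** For a fixed direction [v], the quotient [q] over nonzero scalars tends to the value at [v] of
    every derivative. *)
Lemma lder_unique {E : tvsType R} {G : topologicalLmodType R}
    (f : E -> G) (x : E) (L M : E -> G) :
  separated_tlm G -> is_lder f x L -> is_lder f x M -> L = M.
Proof.
move=> sepG fL fM; apply/funext => v.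
pose q (t : R^o) := t^-1 *: (f (x + t *: v) - f x).
suff H N : is_lder f x N -> q @ (0 : R^o)^' --> N v.
  exact: (separated_cvg_unique sepG (H _ fL) (H _ fM)).
case=> linN cN [r r0 fr].
have pv : (fun t : R^o => (t, v)) @ (0 : R^o)^' --> ((0 : R^o), v).
  by apply: nbhs_cvg_pair; [exact: nbhs_dnbhs|exact: cvg_cst].
have qr : \forall t \near (0 : R^o)^', N v + r (t, v) = q t.
  have /= h := pv _ (fr v); near=> t.
  have -> : q t = t^-1 *: (t *: (N v + r (t, v))).
    rewrite /q; have -> : f (x + t *: v) = f x + t *: (N v + r (t, v)).
      by near: t.
    by rewrite addrAC subrr add0r.
  rewrite scalerA mulVf ?scale1r//; near: t; exact: nbhs_dnbhs_neq.
have h : (fun t => N v + r (t, v)) @ (0 : R^o)^' --> N v.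
  rewrite -[X in _ --> X]addr0; apply: tlm_cvgD; first exact: cvg_cst.
  exact: (cvg_comp _ _ pv (r0 v)).
by apply: cvg_trans h; apply: near_eq_cvg; apply: filterS qr.
Unshelve. all: by end_near. Qed.

Lemma lder_Df {E : tvsType R} {G : topologicalLmodType R}
    (f : E -> G) (x : E) (L : E -> G) :
  separated_tlm G -> is_lder f x L -> Df f x = L.
Proof.
move=> sepG fL; apply: (lder_unique sepG _ fL); apply: lderDf.
by exists L; apply/leslieP.
Qed.

(** Equal germs have equal sets of derivatives, so [xget] makes the same choice, even where that set
    is empty. *)
Lemma Df_ext {E : tvsType R} {G : preTopologicalLmodType R}
    (f g : E -> G) (x : E) :
  (\forall y \near x, f y = g y) -> Df f x = Df g x.
Proof.
move=> fg; rewrite /Df; congr xget; apply/seteqP.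
split=> L /= /leslieP h; apply/leslieP; apply: lder_ext h => //.
by near do apply/esym.
Unshelve. all: by end_near. Qed.

(** [f] moves [x + t w] to [f x + t (L w + r)], so [g] is differentiated in the varying direction
    [L w + r]. This works because the remainder of [g] tends to 0 jointly in the scalar and the
    direction. *)
Lemma lder_comp {E E' : tvsType R} {G : topologicalLmodType R}
    (f : E -> E') (g : E' -> G) (x : E) (L : E -> E') (M : E' -> G) :
  is_lder f x L -> is_lder g (f x) M -> is_lder (g \o f) x (M \o L).
Proof.
move=> [linL cL [r r0 fr]] [linM cM [s s0 gs]]; split.
- by move=> a y z; rewrite /= linL linM.
- by move=> y; apply: continuous_comp; [exact: cL|exact: cM].
have cw v : (fun p : R^o * E => (p.1, L p.2 + r p)) @ nbhs ((0 : R^o), v)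
    --> ((0 : R^o), L v).
  apply: nbhs_cvg_pair; first exact: nbhs_cvg_fst.
  rewrite -[X in _ --> X]addr0; apply: tlm_cvgD; last exact: r0.
  exact: (cvg_comp _ _ (@nbhs_cvg_snd _ _ _ _) (cL v)).
exists (fun p => M (r p) + s (p.1, L p.2 + r p)) => v.
  rewrite -[X in _ --> X]addr0; apply: tlm_cvgD.
    by rewrite -(lin0 linM); exact: (cvg_comp _ _ (r0 v) (cM 0)).
  exact: (cvg_comp _ _ (cw v) (s0 _)).
have /= h1 := fr v; have /= h2 := cw v _ (gs (L v)).
near=> p; rewrite /=.
have -> : f (x + p.1 *: p.2) = f x + p.1 *: (L p.2 + r p) by near: p.
have -> : g (f x + p.1 *: (L p.2 + r p)) =
   g (f x) + p.1 *: (M (L p.2 + r p) + s (p.1, L p.2 + r p)) by near: p.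
by rewrite (linD linM) addrA.
Unshelve. all: by end_near. Qed.

Lemma lder_lin {E : tvsType R} {G : preTopologicalLmodType R}
    (L : E -> G) (x : E) : linear L -> continuous L -> is_lder L x L.
Proof.
move=> linL cL; split => //; exists (fun=> 0) => v; first exact: cvg_cst.
by apply: filterE => p; rewrite addr0 (linD linL) (linZ linL).
Qed.

Lemma lder_cst {E : tvsType R} {G : preTopologicalLmodType R}
    (c : G) (x : E) : is_lder (fun _ : E => c) x (fun=> 0).
Proof.
split; first by move=> a u v; rewrite scaler0 addr0.
  by move=> y; exact: cvg_cst.
exists (fun=> 0) => v; first exact: cvg_cst.
by apply: filterE => p; rewrite addr0 scaler0 addr0.
Qed.

Lemma lder_pair {E G H : tvsType R} (f : E -> G) (g : E -> H) (x : E) L M :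
  is_lder f x L -> is_lder g x M ->
  is_lder (G := tprod G H) (fun y => (f y, g y)) x (fun v => (L v, M v)).
Proof.
move=> [linL cL [r r0 fr]] [linM cM [s s0 gs]]; split.
- by move=> a y z; rewrite linL linM.
- by move=> y; apply: nbhs_cvg_pair; [exact: cL|exact: cM].
exists (fun p => (r p, s p)) => v; first by apply: nbhs_cvg_pair.
have h1 := fr v; have h2 := gs v.
near=> p.
have -> : f (x + p.1 *: p.2) = f x + p.1 *: (L p.2 + r p) by near: p.
by have -> : g (x + p.1 *: p.2) = g x + p.1 *: (M p.2 + s p) by near: p.
Unshelve. all: by end_near. Qed.

Lemma lder_bilin {E1 E2 : tvsType R} {G : topologicalLmodType R}
    (B : E1 * E2 -> G) (z : E1 * E2) :
  (forall x, linear (fun y => B (x, y))) ->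
  (forall y, linear (fun x => B (x, y))) -> continuous B ->
  is_lder B z (fun h => B (z.1, h.2) + B (h.1, z.2)).
Proof.
move=> B2 B1 cB; split.
- move=> a u v /=; rewrite (B2 z.1) (B1 z.2) scalerDr !addrA.
  by congr (_ + _); rewrite -!addrA; congr (_ + _); rewrite addrC.
- move=> y; apply: tlm_cvgD.
    apply: (@continuous_comp _ _ _ (fun h : E1 * E2 => (z.1, h.2)) B);
      last exact: cB.
    by apply: nbhs_cvg_pair; [exact: cvg_cst|exact: nbhs_cvg_snd].
  apply: (@continuous_comp _ _ _ (fun h : E1 * E2 => (h.1, z.2)) B);
    last exact: cB.
  by apply: nbhs_cvg_pair; [exact: nbhs_cvg_fst|exact: cvg_cst].
(* The second order term [t^2 B(h, k)], divided by [t]. *)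
exists (fun p => p.1 *: B p.2) => v.
  rewrite -[X in _ --> X](scale0r (B v)); apply: tlm_cvgZ; first exact:
    nbhs_cvg_fst.
  exact: (cvg_comp _ _ (@nbhs_cvg_snd _ _ _ _) (cB v)).
apply: filterE => -[t [h k]] /=; case: z => x y /=.
rewrite (linD (B2 _)) (linZ (B2 _)) (linD (B1 _)) (linZ (B1 _)).
rewrite (linD (B1 _)) (linZ (B1 _)) !scalerDr -!addrA; congr (_ + _).
by rewrite addrCA.
Qed.

End TopologicalModules.

(** * Closure properties of maps of class C^n *)

Section ClassC.
Context {R : realType}.

#[export] Instance separated_prod {G H : tvsType R} :
  separated_tlm G -> separated_tlm H -> separated_tlm (tprod G H).
Proof.
move=> sG sH [x y] h; congr (_, _).
  apply: sG => U U0; apply: (h (fst @^-1` U)).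
  exact: (@nbhs_cvg_fst _ _ (0 : G) (0 : H) _ U0).
apply: sH => U U0; apply: (h (snd @^-1` U)).
exact: (@nbhs_cvg_snd _ _ (0 : G) (0 : H) _ U0).
Qed.

#[export] Instance separated_normed (G : normedModType R) : separated_tlm (G :
  tvsType R).
Proof.
move=> x h; apply/eqP; apply: contraT => x0; have x_gt0 : 0 < `|x| by rewrite
  normr_gt0.
have := h (ball 0 `|x|); rewrite -ball_normE /= sub0r normrN ltxx; apply.
by apply/nbhs_ballP; exists `|x|; rewrite //= -ball_normE.
Qed.

#[export] Instance separated_regular : separated_tlm (R^o : tvsType R).
Proof. exact: (@separated_normed (R^o : normedModType R)). Qed.

Lemma openXT {E F : topologicalType} (U : set E) :
  open U -> open (U `*` [set: F]).
Proof.
move=> oU; rewrite (_ : _ `*` _ = (fun p : E * F => p.1) @^-1` U).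
  by apply: open_comp => // -[x y] _; exact: nbhs_cvg_fst.
by apply/seteqP; split=> [[x y] []|[x y]].
Qed.

Lemma for_cvg {T U : topologicalType} (f : T -> U) x :
  {for x, continuous f} <-> f @ nbhs x --> f x.
Proof. by []. Qed.

Lemma class_C_cts n {E : tvsType R} {G : preTopologicalLmodType R} (U : set E)
  (f : E -> G) : class_C n U f -> forall x, U x -> f @ nbhs x --> f x.
Proof. by case: n => [|n] []. Qed.

Lemma class_C_diff n {E : tvsType R} {G : preTopologicalLmodType R} (U : set E)
  (f : E -> G) : class_C n.+1 U f -> forall x, U x -> is_lder f x (Df f x).
Proof. by move=> [_ [h _]] x Ux; exact: lderDf (h x Ux). Qed.

Lemma class_C_D n {E : tvsType R} {G : preTopologicalLmodType R} (U : set E)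
  (f : E -> G) : class_C n.+1 U f ->
  class_C n (U `*` [set: E]) (fun p => Df f p.1 p.2).
Proof. by case=> _ []. Qed.

Lemma class_C_sub n {E : tvsType R} {G : preTopologicalLmodType R}
    (U V : set E) (f : E -> G) :
  U `<=` V -> class_C n V f -> class_C n U f.
Proof.
elim: n E U V f => [|n IH] E U V f UV [cf h]; split => //.
- by move=> x /UV; exact: cf.
- by move=> x /UV; exact: cf.
case: h => df cdf; split; first by move=> x /UV; exact: df.
by apply: IH cdf => -[x v] [/UV].
Qed.

Lemma class_CW n {E : tvsType R} {G : preTopologicalLmodType R}
    (U : set E) (f : E -> G) : class_C n.+1 U f -> class_C n U f.
Proof.
elim: n E U f => [|n IH] E U f [cf [df cdf]]; split => //; split => //.
exact: IH.
Qed.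

Lemma class_C_ext n {E : tvsType R} {G : preTopologicalLmodType R}
    (U : set E) (f g : E -> G) :
  open U -> (forall x, U x -> f x = g x) -> class_C n U f -> class_C n U g.
Proof.
have near_fg (E' : tvsType R) (V : set E') (f' g' : E' -> G) : open V ->
    (forall x, V x -> f' x = g' x) -> forall x, V x -> \forall y \near x, f' y
      = g' y.
  by move=> oV fg x Vx; apply: filterS (open_nbhs_nbhs (conj oV Vx)).
have cts (E' : tvsType R) (V : set E') (f' g' : E' -> G) : open V ->
    (forall x, V x -> f' x = g' x) -> (forall x, V x -> {for x, continuous f'})
      ->
    forall x, V x -> {for x, continuous g'}.
  move=> oV fg cf x Vx; apply/for_cvg; rewrite -(fg x Vx).
  apply: cvg_trans (cf x Vx); apply: near_eq_cvg.
  by apply: filterS (near_fg _ _ _ _ oV fg x Vx).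
elim: n E U f g => [|n IH] E U f g oU fg [cf h]; split => //.
- exact: cts cf.
- exact: cts cf.
case: h => df cdf; split.
  move=> x Ux; have [L /leslieP hL] := df x Ux.
  by exists L; apply/leslieP; apply: lder_ext hL; exact: near_fg oU fg x Ux.
apply: IH cdf; first exact: openXT.
move=> [x v] [/= Ux _]; congr (_ v); apply: Df_ext; exact: near_fg oU fg x Ux.
Qed.

(** The introduction rule of the inductions on [n] below: an explicit [f'] replaces the chosen [Df],
    and separation identifies the two. *)
Lemma class_C_S n {E : tvsType R} {G : topologicalLmodType R}
    {sG : separated_tlm G} (U : set E) (f : E -> G) (f' : E * E -> G) :
  open U -> (forall x, U x -> f @ nbhs x --> f x) ->
  (forall x, U x -> is_lder f x (fun v => f' (x, v))) ->
  class_C n (U `*` [set: E]) f' -> class_C n.+1 U f.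
Proof.
move=> oU cf df cf'; split => //; split.
  by move=> x Ux; eexists; apply/leslieP; exact: df.
apply: class_C_ext cf'; first exact: openXT.
by move=> [x v] [/= Ux _]; rewrite (lder_Df sG (df x Ux)).
Qed.

Lemma class_C_lin n {E : tvsType R} {G : topologicalLmodType R}
    {sG : separated_tlm G} (U : set E) (f : E -> G) :
  linear f -> continuous f -> class_C n U f.
Proof.
move=> linf cf; apply: (@class_C_sub _ _ _ _ setT) => // {U}.
elim: n E f linf cf => [|n IH] E f linf cf; first by split=> // x _; exact: cf.
apply: (@class_C_S _ _ _ _ _ _ (f \o snd)); first exact: openT.
- by move=> x _; exact: cf.
- by move=> x _; exact: lder_lin.
apply: class_C_sub (subsetT _) _; apply: IH.
  by move=> a x y; rewrite /= linf.
by move=> [x y]; apply: continuous_comp; [exact: nbhs_cvg_snd|exact: cf].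
Qed.

Lemma class_C_cst n {E : tvsType R} {G : topologicalLmodType R}
    {sG : separated_tlm G} (U : set E) (c : G) : class_C n U (fun=> c).
Proof.
apply: (@class_C_sub _ _ _ _ setT) => // {U}.
elim: n E c => [|n IH] E c; first by split=> // x _; exact: cvg_cst.
apply: (@class_C_S _ _ _ _ _ _ (fun=> 0)); first exact: openT.
- by move=> x _; exact: cvg_cst.
- by move=> x _; exact: lder_cst.
exact: class_C_sub (subsetT _) _.
Qed.

Lemma class_C_fst n {E F : tvsType R} {sE : separated_tlm E} (U : set (E * F)) :
  class_C n U (fun p => p.1).
Proof. by apply: class_C_lin => // -[x y]; exact: nbhs_cvg_fst. Qed.

Lemma class_C_snd n {E F : tvsType R} {sF : separated_tlm F} (U : set (E * F)) :
  class_C n U (fun p => p.2).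
Proof. by apply: class_C_lin => // -[x y]; exact: nbhs_cvg_snd. Qed.

Lemma class_C_pair n {E G H : tvsType R} {sG : separated_tlm G}
    {sH : separated_tlm H} (U : set E) (f : E -> G) (g : E -> H) :
  open U -> class_C n U f -> class_C n U g ->
  class_C n (G := tprod G H) U (fun x => (f x, g x)).
Proof.
elim: n E U f g => [|n IH] E U f g oU Cf Cg.
  by split => // x Ux; apply: nbhs_cvg_pair; [exact: class_C_cts Cf x Ux|exact:
    class_C_cts Cg x Ux].
apply: (@class_C_S _ _ (tprod G H) _ _ _ (fun p => (Df f p.1 p.2, Df g p.1
  p.2))) => //.
- by move=> x Ux; apply: nbhs_cvg_pair; [exact: class_C_cts Cf x Ux|exact:
    class_C_cts Cg x Ux].
- by move=> x Ux; apply: lder_pair; [exact: class_C_diff Cf _ Ux|exact: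
    class_C_diff Cg _ Ux].
by apply: IH; [exact: openXT|exact: class_C_D|exact: class_C_D].
Qed.

(** The derivative of a composite, as a map of [(x, v)], is again a composite: [Dg] after
    [(f x, Df(x) v)]. The induction ranges over all spaces because the domains double. *)
Lemma class_C_comp n {E E' : tvsType R} {G : topologicalLmodType R}
    {sE : separated_tlm E} {sE' : separated_tlm E'} {sG : separated_tlm G}
    (U : set E) (V : set E') (f : E -> E') (g : E' -> G) :
  open U -> open V -> (forall x, U x -> V (f x)) ->
  class_C n U f -> class_C n V g -> class_C n U (fun x => g (f x)).
Proof.
elim: n E E' G sE sE' sG U V f g => [|n IH] E E' G sE sE' sG U V f g oU oV UV
  Cf Cg.
  split=> // x Ux; apply: continuous_comp; first exact: class_C_cts Cf x Ux.
  exact: class_C_cts Cg _ (UV _ Ux).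
apply: (@class_C_S _ _ _ _ _ _ (fun p => Df g (f p.1) (Df f p.1 p.2))) => //.
- move=> x Ux; apply: continuous_comp; first exact: class_C_cts Cf x Ux.
  exact: class_C_cts Cg _ (UV _ Ux).
- move=> x Ux; exact: (lder_comp (f := f) (g := g)
    (class_C_diff Cf Ux) (class_C_diff Cg (UV _ Ux))).
have oUE := @openXT _ E _ oU.
apply: (@IH _ (tprod E' E') _ _ _ _ _ (V `*` setT) (fun p => (f p.1, Df f p.1
  p.2))
   (fun q => Df g q.1 q.2)) => //.
- exact: openXT.
- by move=> [x v] [/= /UV].
- apply: class_C_pair => //; last exact: class_C_D.
  apply: (@IH _ _ _ _ _ _ _ U fst f) => //; first by move=> [x v] [].
  + exact: class_C_fst.
  + exact: class_CW.
- exact: class_C_D.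
Qed.

Lemma class_C_id n {E : tvsType R} {sE : separated_tlm E} (U : set E) :
  class_C n U (fun x : E => x).
Proof. by apply: class_C_lin => // x; exact: cvg_id. Qed.

Lemma class_C_fstc n {E G H : tvsType R} {sE : separated_tlm E}
    {sG : separated_tlm G} {sH : separated_tlm H} (U : set E) (f : E -> G * H) :
  open U -> class_C n (G := tprod G H) U f -> class_C n U (fun x => (f x).1).
Proof.
move=> oU Cf; apply: (@class_C_comp _ _ (tprod G H) _ _ _ _ _ setT f fst) => //.
  exact: openT.
exact: class_C_fst.
Qed.

Lemma class_C_sndc n {E G H : tvsType R} {sE : separated_tlm E}
    {sG : separated_tlm G} {sH : separated_tlm H} (U : set E) (f : E -> G * H) :
  open U -> class_C n (G := tprod G H) U f -> class_C n U (fun x => (f x).2).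
Proof.
move=> oU Cf; apply: (@class_C_comp _ _ (tprod G H) _ _ _ _ _ setT f snd) => //.
  exact: openT.
exact: class_C_snd.
Qed.

End ClassC.

Ltac proj_C := first [exact: openT | by repeat apply: openXT
  | exact: class_C_id | exact: class_C_fst | exact: class_C_snd
  | apply: class_C_pair => //; proj_C
  | apply: class_C_fstc => //; proj_C | apply: class_C_sndc => //; proj_C].

Section ClassCBilinear.
Context {R : realType}.

Lemma class_C_bilin n {E1 E2 : tvsType R} {G : tvsType R} {s1 : separated_tlm
  E1}
    {s2 : separated_tlm E2} {sG : separated_tlm G} (B : E1 * E2 -> G) U :
  (forall x, linear (fun y => B (x, y))) ->
  (forall y, linear (fun x => B (x, y))) -> continuous B ->
  class_C n U B.
Proof.
move=> B2 B1 cB; apply: (@class_C_sub _ _ _ _ _ setT) => // {U}.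
elim: n => [|n IH]; first by split=> // x _; exact: cB.
apply: (@class_C_S _ _ _ _ _ _ _
   (fun p => B (p.1.1, p.2.2) + B (p.2.1, p.1.2))); first exact: openT.
- by move=> x _; exact: cB.
- by move=> x _; exact: lder_bilin.
apply: (@class_C_sub _ _ _ _ _ setT) => //.
apply: (@class_C_comp _ _ _ (tprod G G) _ _ _ _ _ setT
  (fun p => (B (p.1.1, p.2.2), B (p.2.1, p.1.2))) (fun q => q.1 + q.2)) => //.
- exact: openT.
- exact: openT.
- have h : forall f : (E1 * E2) * (E1 * E2) -> E1 * E2,
    class_C n (G := tprod E1 E2) setT f -> class_C n setT (B \o f).
    move=> f Cf.
    apply: (@class_C_comp _ _ _ (tprod E1 E2) _ _ _ _ _ setT f B) => //.
    + exact: openT.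
    + exact: openT.
  apply: class_C_pair; first exact: openT.
  + apply: (h (fun p => (p.1.1, p.2.2))); proj_C.
  + apply: (h (fun p => (p.2.1, p.1.2))); proj_C.
- apply: class_C_lin; last exact: add_continuous.
  move=> a [x y] [x' y'] /=; rewrite scalerDr -!addrA; congr (_ + _).
  by rewrite addrCA.
Qed.

Lemma class_CD n {E G : tvsType R} {sE : separated_tlm E} {sG : separated_tlm G}
    (U : set E) (f g : E -> G) :
  open U -> class_C n U f -> class_C n U g -> class_C n U (fun x => f x + g x).
Proof.
move=> oU Cf Cg.
apply: (@class_C_comp _ _ _ (tprod G G) _ _ _ _ _ setT
  (fun x => (f x, g x)) (fun q => q.1 + q.2)) => //.
- exact: openT.
- exact: class_C_pair.
- apply: class_C_lin; last exact: add_continuous.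
  move=> a [x y] [x' y'] /=; rewrite scalerDr -!addrA; congr (_ + _).
  by rewrite addrCA.
Qed.

End ClassCBilinear.

(** * Bounded convergence on spaces of continuous linear maps *)

Section Clin.
Context {R : realType}.

Lemma near0_add {E : topologicalLmodType R} (U : set E) : nbhs 0 U ->
  exists2 V : set E, nbhs 0 V & forall x y, V x -> V y -> U (x + y).
Proof.
move=> U0; have := @add_continuous E (0, 0) U; rewrite /= addr0 => /(_ U0).
case=> -[A B] /= [A0 B0] AB; exists (A `&` B); first exact: filterI.
by move=> x y [Ax _] [_ By]; exact: (AB (x, y)).
Qed.

Lemma near_scale {E : topologicalLmodType R} (U : set E) (t : R^o) (x : E) :
  nbhs (t *: x) U ->
  exists (T : set R^o) (V : set E),
    [/\ nbhs t T, nbhs x V & forall s y, T s -> V y -> U (s *: y)].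
Proof.
move=> /(@scale_continuous R E (t, x) U) [] [T V] /= [T0 V0] TV.
by exists T, V; split=> // s y Ts Vy; exact: (TV (s, y)).
Qed.

Section OneClin.
Context {E F : tvsType R}.
Implicit Types l m : clin E F.

Lemma clin_lin l : linear l.
Proof. by have := clinP l; rewrite inE => -[]. Qed.

Lemma clin_cont l : continuous l.
Proof. by have := clinP l; rewrite inE => -[]. Qed.

Lemma clin_addE l m x : (l + m) x = l x + m x. Proof. by []. Qed.
Lemma clin_scaleE a l x : (a *: l) x = a *: l x. Proof. by []. Qed.
Lemma clin_zeroE x : (0 : clin E F) x = 0. Proof. by []. Qed.

Lemma clin_ext l m : (forall x, l x = m x) -> l = m.
Proof. by move=> h; apply: val_inj; apply/funext. Qed.

Lemma mk_clin (f : E -> F) : linear f -> continuous f ->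
  exists l : clin E F, forall x, l x = f x.
Proof.
move=> linf cf; have fP : f \in @clin_pred R E F by rewrite inE.
by exists (CLin fP).
Qed.

Lemma nbhs_clinP l (A : set (clin E F)) :
  nbhs l A <-> exists (B : set E) (U : set F), [/\ vbounded B, nbhs 0 U &
    forall m, (forall x, B x -> U (m x - l x)) -> A m].
Proof.
split=> [|[B [U [bB U0 BU]]]].
  rewrite nbhsE => -[V [oV Vl] VA]; have [B [U [bB U0 BU]]] := oV l Vl.
  by exists B, U; split => // m h; apply: VA; exact: BU.
(* The basic set given by [B] and [U] need not be open. [N] keeps the [m] that leave some uniform
   room [V] inside [U], and this set is open. *)
pose N := [set m : clin E F | exists2 V : set F, nbhs 0 V &
  forall x z, B x -> V z -> U (m x - l x + z)].
rewrite nbhsE; exists N; first split.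
- move=> m [V V0 BV]; have [W W0 WV] := near0_add V0.
  exists B, W; split => // k kW; exists W => // x z Bx Wz.
  rewrite (_ : k x - l x + z = m x - l x + (k x - m x + z)).
    by apply: BV => //; apply: WV => //; exact: kW.
  by rewrite addrA; congr (_ + _); rewrite [RHS]addrC addrA subrK.
- by exists U => // x z _ Uz; rewrite subrr add0r.
- move=> m [V V0 BV]; apply: BU => x Bx; rewrite -[_ - _]addr0.
  by apply: BV => //; exact: nbhs_singleton.
Qed.

Lemma cvg_clinP {T : Type} (FF : set_system T) {filtFF : Filter FF}
    (f : T -> clin E F) l :
  f @ FF --> l <-> forall (B : set E) (U : set F), vbounded B -> nbhs 0 U ->
    \forall x \near FF, forall v, B v -> U (f x v - l v).
Proof.
split=> [fl B U bB U0|h A /nbhs_clinP[B [U [bB U0 BU]]]].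
  by apply: (fl [set m | forall v, B v -> U (m v - l v)]); apply/nbhs_clinP;
    exists B, U.
by have := h B U bB U0; apply: filterS => x; exact: BU.
Qed.

Lemma vbounded_image (B : set E) l : vbounded B -> vbounded (l @` B).
Proof.
move=> bB U U0.
have /bB : nbhs 0 (l @^-1` U).
  by apply: (@clin_cont l 0 U); rewrite (lin0 (clin_lin l)).
apply: filterS => t h _ [x Bx <-].
by rewrite -(linZ (clin_lin l)); exact: h.
Qed.

Lemma clin_add_continuous :
  continuous (fun p : clin E F * clin E F => p.1 + p.2).
Proof.
move=> [l m]; apply/cvg_clinP => B U bB U0; have [V V0 VU] := near0_add U0.
have /cvg_clinP/(_ B V bB V0) h1 := @nbhs_cvg_fst _ _ l m.
have /cvg_clinP/(_ B V bB V0) h2 := @nbhs_cvg_snd _ _ l m.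
near=> p => v Bv; rewrite -[X in U X]/((p.1 v + p.2 v) - (l v + m v)) opprD
  addrACA.
by apply: VU; move: v Bv; near: p.
Unshelve. all: by end_near. Qed.

Lemma clin_scale_continuous :
  continuous (fun p : R^o * clin E F => p.1 *: p.2).
Proof.
move=> [t l]; apply/cvg_clinP => B U bB U0; have [V V0 VU] := near0_add U0.
have V0' : nbhs (t *: (0 : F)) V by rewrite scaler0.
have [T [W [T0 W0 TW]]] := near_scale V0'.
have /cvg_clinP/(_ B W bB W0) h1 := @nbhs_cvg_snd _ _ t l.
have h2 := @nbhs_cvg_fst _ _ t l _ T0.
have h3 : (fun p : R^o * clin E F => p.1 - t) @ nbhs (t, l) --> (0 : R^o).
  rewrite -[X in _ --> X](subrr t).
  by apply: (@tlm_cvgB _ _ _ _ (R^o : tvsType R)); [exact: nbhs_cvg_fst|exact: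
    cvg_cst].
(* For the term [(p.1 - t) *: l v]: the image of [B] under [l] is bounded, so its multiples by
   [p.1 - t] are uniformly small. *)
have h4 := h3 _ (vbounded_image l bB V0).
near=> p => v Bv; rewrite -[X in U X]/(p.1 *: p.2 v - t *: l v).
rewrite (_ : _ - _ = p.1 *: (p.2 v - l v) + (p.1 - t) *: l v); last first.
  by rewrite scalerBr scalerBl addrA subrK.
apply: VU; last first.
  have : [set l x | x in B] (l v) by exists v.
  by move: (l v); near: p.
apply: TW; first by near: p.
by move: v Bv; near: p.
Unshelve. all: by end_near. Qed.

End OneClin.

End Clin.

HB.instance Definition _ (R : realType) (E F : tvsType R) :=
  PreTopologicalNmodule_isTopologicalNmodule.Build (clin E F)
    (@clin_add_continuous R E F).
HB.instance Definition _ (R : realType) (E F : tvsType R) :=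
  TopologicalNmodule_isTopologicalLmodule.Build R (clin E F)
    (@clin_scale_continuous R E F).

(** * Evaluation of operators and first countability *)

Section ClinEval.
Context {R : realType}.

Lemma tlm_cvg_sub {T : Type} {F : set_system T} {FF : Filter F}
    {G : topologicalLmodType R} (g f : T -> G) (a : G) :
  (fun x => f x - g x) @ F --> (0 : G) -> g @ F --> a -> f @ F --> a.
Proof.
move=> fg ga; rewrite -[a]add0r (_ : f = (fun x => f x - g x + g x)).
  exact: tlm_cvgD.
by apply/funext => x; rewrite subrK.
Qed.

Lemma near_ltn {T : Type} {F : set_system T} {FF : Filter F} (Q : nat -> set T)
  :
  (forall n, F (Q n)) ->
  forall n, F [set x | forall i, (i < n)%N -> Q i x].
Proof.
move=> FQ; elim=> [|n IH]; first exact: filterE.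
apply: filterS (filterI IH (FQ n)) => x [Ix Qx] i.
by rewrite ltnS leq_eqVlt => /orP[/eqP ->|/Ix].
Qed.

Lemma vbounded1 {E : tvsType R} (v : E) : vbounded [set v].
Proof.
move=> U U0; have U0' : nbhs ((0 : R^o) *: v) U by rewrite scale0r.
have [T [V [T0 V0 TV]]] := near_scale U0'.
apply: filterS T0 => t Tt _ ->; apply: TV => //; exact: nbhs_singleton.
Qed.

#[export] Instance separated_clin {E F : tvsType R} :
  separated_tlm F -> separated_tlm (clin E F : topologicalLmodType R).
Proof.
move=> sF l h; apply: clin_ext => v; rewrite clin_zeroE.
apply: sF => U U0; apply: (h [set m : clin E F | U (m v)]).
apply/nbhs_clinP; exists [set v], U; split => //; first exact: vbounded1.
by move=> m /(_ v erefl); rewrite clin_zeroE subr0.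
Qed.

Lemma clin_eval_cont {E F : tvsType R} (v : E) :
  continuous (fun l : clin E F => l v).
Proof.
move=> l.
apply: (@tlm_cvg_sub _ (nbhs l) _ F (fun=> l v) (fun m => m v) (l v)); last
  exact: cvg_cst.
move=> U U0.
have h := iffLR (@cvg_clinP _ _ _ _ (nbhs l) (nbhs_filter l) id l) cvg_id _ _
  (vbounded1 v) U0.
suff : nbhs l [set m : clin E F | U (m v - l v)] by [].
by apply: filterS h => m /(_ v erefl).
Qed.

Definition countably_based {T : Type} (F : set_system T) : Prop :=
  exists A : nat -> set T, [/\ forall n, F (A n),
    forall n m, (n <= m)%N -> A m `<=` A n &
    forall P, F P -> exists n, A n `<=` P].

Class first_countable (T : topologicalType) : Prop :=
  first_countableP : forall x : T, countably_based (nbhs x).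

#[export] Instance first_countable_prod {T U : topologicalType} :
  first_countable T -> first_countable U -> first_countable (T * U)%type.
Proof.
move=> cT cU [x y]; have [A [FA monA basA]] := cT x.
have [B [FB monB basB]] := cU y.
exists (fun n => A n `*` B n); split.
- by move=> n; exists (A n, B n) => /=; [split|move=> z].
- by move=> n m nm [a b] [/= /(monA _ _ nm) ? /(monB _ _ nm) ?].
- move=> P [[V W] /= [/basA[n nV] /basB[m mW]] VW].
  exists (maxn n m) => -[a b] [/= Aa Bb]; apply: VW; split => /=.
    by apply: nV; apply: monA Aa; exact: leq_maxl.
  by apply: mW; apply: monB Bb; exact: leq_maxr.
Qed.

#[export] Instance first_countable_normed (V : normedModType R) :
  first_countable V.
Proof.
move=> x; exists (fun n => ball x n.+1%:R^-1); split.
- by move=> n; apply: nbhsx_ballx; rewrite invr_gt0.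
- by move=> n m nm; apply: le_ball; rewrite lef_pV2 ?posrE// ler_nat.
- move=> P /nbhs_ballP[e /= e0 eP]; have [n _ ne] := near_infty_natSinv_lt
    (PosNum e0).
  exists n => y yb; apply: eP; apply: le_ball yb; apply/ltW.
  by have := ne n (leqnn n).
Qed.

#[export] Instance first_countable_regular : first_countable (R^o : tvsType R).
Proof. exact: (@first_countable_normed (R^o : normedModType R)). Qed.

(* A convergent sequence is bounded, so the topology of bounded convergence
   controls evaluation along it; hence first countability. *)
Lemma cvg_clin_eval {E G : tvsType R} {T : Type} {F : set_system T}
    {FF : Filter F} (m : T -> clin E G) (e : T -> E) (l : clin E G) (v : E) :
  countably_based F -> m @ F --> l -> e @ F --> v ->
  (fun x => m x (e x)) @ F --> l v.
Proof.
move=> [A [FA monA basA]] ml ev.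
apply: (@tlm_cvg_sub _ F _ G (l \o e) (fun x => m x (e x)) (l v));
  last exact: (cvg_comp _ _ ev (@clin_cont _ _ _ l v)).
move=> U U0; apply: contrapT => nU.
(* If the claim fails for [U], each set [A n] of the decreasing base contains a bad point. The
   sequence [x] of bad points eventually enters every set of [F], so [e] converges along it. *)
have /choice[x xP] : forall n, exists x, A n x /\ ~ U (m x (e x) - l (e x)).
  move=> n; apply: contrapT => nx; apply: nU.
  suff : F [set x | U (m x (e x) - l (e x))] by [].
  apply: filterS (FA n) => x Ax.
  by apply: contrapT => nUx; apply: nx; exists x.
(* From [N] on, the points lie in [V], which the scalars of [S] send into [W]; the finitely many
   earlier points are absorbed one by one. *)
have bB : vbounded (range (e \o x)).
  move=> W W0; have W0' : nbhs ((0 : R^o) *: v) W by rewrite scale0r.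
  have [S [V [S0 V0 SV]]] := near_scale W0'.
  have [N AN] := basA _ (ev _ V0).
  have hN : \forall t \near (0 : R^o), forall n, (n < N)%N -> W (t *: e (x n)).
    apply: near_ltn => n; apply: filterS (vbounded1 (e (x n)) W0) => t.
    exact.
  near=> t => _ [n _ <-] /=; case: (ltnP n N) => nN.
    by move: n nN; near: t.
  apply: SV; first by near: t.
  by apply: AN; apply: (monA _ _ nN); have [] := xP n.
have /cvg_clinP/(_ _ _ bB U0)/basA[k Ak] := ml.
have [Axk nUk] := xP k; apply: nUk; by apply: Ak.
Unshelve. all: by end_near. Qed.

Lemma lder_eval {E' E G : tvsType R} {cE' : first_countable E'}
    {cE : first_countable E} (m : E' -> clin E G) (M : E' -> clin E G)
    (z : E' * E) :
  is_lder m z.1 M ->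
  is_lder (fun p : E' * E => m p.1 p.2) z (fun h => M h.1 z.2 + m z.1 h.2).
Proof.
case: z => z v [linM cM [r r0 mr]] /=; split.
- move=> a [h k] [h' k'] /=; rewrite linM (clin_lin (m z)) clin_addE
    clin_scaleE.
  by rewrite scalerDr -!addrA; congr (_ + _); rewrite addrCA.
- move=> [h k]; apply: tlm_cvgD.
    apply: (@continuous_comp _ _ _ (M \o fst) (fun l : clin E G => l v)).
      by apply: continuous_comp; [exact: nbhs_cvg_fst|exact: cM].
    exact: clin_eval_cont.
  by apply: continuous_comp; [exact: nbhs_cvg_snd|exact: clin_cont].
(* What remains of [(m z + t (M h + r)) (v + t k)] beyond first order, divided by [t]. In both
   summands operator and argument move together, so their convergence goes through [cvg_clin_eval]
   and a countable base. *)
pose r' (p : R^o * (E' * E)) : G := M p.2.1 (p.1 *: p.2.2) +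
  r (p.1, p.2.1) (v + p.1 *: p.2.2).
have cb (k : E' * E) : countably_based (nbhs ((0 : R^o), k)).
  exact: (@first_countable_prod R^o (E' * E)%type).
have c2 (h : E') (k : E) : (fun p : R^o * (E' * E) => p.2) @ nbhs ((0 : R^o),
  (h, k)) --> (h, k).
  exact: (@nbhs_cvg_snd R^o (E' * E)%type 0 (h, k)).
have c21 (h : E') (k : E) : (fun p : R^o * (E' * E) => p.2.1) @ nbhs ((0 :
  R^o), (h, k)) --> h.
  exact: (cvg_comp _ _ (c2 h k) (@nbhs_cvg_fst _ _ h k)).
have c22 (h : E') (k : E) : (fun p : R^o * (E' * E) => p.2.2) @ nbhs ((0 :
  R^o), (h, k)) --> k.
  exact: (cvg_comp _ _ (c2 h k) (@nbhs_cvg_snd _ _ h k)).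
have c1 (h : E') (k : E) :
    (fun p : R^o * (E' * E) => p.1) @ nbhs ((0 : R^o), (h, k)) --> (0 : R^o).
  exact: (@nbhs_cvg_fst R^o (E' * E)%type 0 (h, k)).
have cq (h : E') (k : E) : (fun p : R^o * (E' * E) => (p.1, p.2.1))
    @ nbhs ((0 : R^o), (h, k)) --> ((0 : R^o), h).
  by apply: nbhs_cvg_pair.
have ct (h : E') (k : E) : (fun p : R^o * (E' * E) => p.1 *: p.2.2)
    @ nbhs ((0 : R^o), (h, k)) --> (0 : E).
  by rewrite -(scale0r k); apply: tlm_cvgZ.
exists r' => -[h k].
  rewrite -[X in _ --> X]addr0; apply: tlm_cvgD.
    rewrite -(lin0 (clin_lin (M h))); apply: cvg_clin_eval => //.
    exact: (cvg_comp _ _ (c21 h k) (cM h)).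
  rewrite -(clin_zeroE (F := G) (v + 0)); apply: cvg_clin_eval => //.
    exact: (cvg_comp _ _ (cq h k) (r0 h)).
  by apply: tlm_cvgD => //; exact: cvg_cst.
have /= hm := cq h k _ (mr h).
near=> p; rewrite /=.
have -> : m (z + p.1 *: p.2.1) = m z + p.1 *: (M p.2.1 + r (p.1, p.2.1)) by
  near: p.
rewrite /r' clin_addE clin_scaleE clin_addE (linD (clin_lin (m z))).
rewrite (linD (clin_lin (M _))) (linZ (clin_lin (m z))) -addrA; congr (_ + _).
rewrite -scalerDr; congr (_ *: _).
by rewrite -!addrA [LHS]addrCA.
Unshelve. all: by end_near. Qed.

(** The derivative is a sum of two evaluations, of [Df m] and of [m]. The first has base space
    [E' * E'], so the induction ranges over all first countable base spaces. *)
Lemma class_C_eval n {E' E G : tvsType R} {cE' : first_countable E'}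
    {cE : first_countable E} {sE' : separated_tlm E'} {sE : separated_tlm E}
    {sG : separated_tlm G} (U : set E') (m : E' -> clin E G) :
  open U -> class_C n U m -> class_C n (U `*` [set: E]) (fun p => m p.1 p.2).
Proof.
elim: n E' cE' sE' U m => [|n IH] E' cE' sE' U m oU Cm.
  split=> // -[z v] [/= Uz _]; apply: cvg_clin_eval.
  + exact: first_countable_prod.
  + exact: (cvg_comp _ _ (@nbhs_cvg_fst _ _ z v) (class_C_cts Cm Uz)).
  + exact: nbhs_cvg_snd.
have oUE := @openXT _ E _ oU.
have oUEE := @openXT _ (E' * E)%type _ oUE.
apply: (@class_C_S _ _ _ _ _ _ _ (fun p : (E' * E) * (E' * E) =>
  Df m p.1.1 p.2.1 p.1.2 + m p.1.1 p.2.2)) => //.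
- move=> [z v] [/= Uz _]; apply: cvg_clin_eval.
  + exact: first_countable_prod.
  + exact: (cvg_comp _ _ (@nbhs_cvg_fst _ _ z v) (class_C_cts Cm Uz)).
  + exact: nbhs_cvg_snd.
- move=> [z v] [/= Uz _]; exact: lder_eval (class_C_diff Cm Uz).
apply: class_CD => //.
  apply: (@class_C_comp _ _ _ (tprod (tprod E' E') E) _ _ _ _ _
     ((U `*` setT) `*` setT) (fun p => ((p.1.1, p.2.1), p.1.2))
     (fun q : (E' * E') * E => Df m q.1.1 q.1.2 q.2)) => //.
  + by apply: openXT; exact: openXT.
  + by proj_C.
  + apply: (IH _ _ _ _ (fun q : E' * E' => Df m q.1 q.2)).
      exact: openXT.
    exact: class_C_D.
apply: (@class_C_comp _ _ _ (tprod E' E) _ _ _ _ _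
     (U `*` setT) (fun p => (p.1.1, p.2.2))
     (fun q : E' * E => m q.1 q.2)) => //.
  + by move=> [[x y] [x' y']] [[]].
  + by proj_C.
  + apply: IH => //; exact: class_CW.
Qed.

End ClinEval.

(** * A mean value theorem for open convex sets *)

Section MeanValue.
Context {R : realType}.

Definition convex {G : lmodType R} (C : set G) : Prop :=
  forall x y (a b : R), 0 <= a -> 0 <= b -> a + b = 1 -> C x -> C y ->
    C (a *: x + b *: y).

Lemma convex_set_convex {G : lmodType R} (C : set G) : convex_set C -> convex C.
Proof.
move=> convC x y a b a0 b0 ab Cx Cy.
have a1 : 0 <= a <= 1 by rewrite a0 -ab lerDl.
have -> : b = 1 - a by rewrite -ab addrC addKr.
have /set_mem := convC x y (Itv01 (proj1 (andP a1)) (proj2 (andP a1)))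
  (mem_set Cx) (mem_set Cy).
exact.
Qed.

Lemma convex_nbhs {G : tvsType R} (x : G) (U : set G) : nbhs x U ->
  exists C : set G, [/\ open C, C x, C `<=` U & convex C].
Proof.
have [B convB [oB basB]] := @locally_convex R G.
move=> /(basB x)[C [/= BC Cx] CU]; exists C; split => //.
- exact: oB.
- by apply: convex_set_convex; apply: convB; rewrite inE.
Qed.

(* The relation [c b - c a] in [(b - a) C] is transitive by convexity of [C] and
   holds locally because [C] is open. *)
Lemma mean_value_convex {G : tvsType R} (c : R^o -> G) (C : set G) :
  open C -> convex C ->
  (forall s : R^o, 0 <= s <= 1 -> exists2 L, is_lder c s L & C (L 1)) ->
  C (c 1 - c 0).
Proof.
move=> oC convC dc.
pose P (a b : R) := exists2 z, C z & c b - c a = (b - a) *: z.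
have Pcat a b d : a <= b -> b <= d -> P a b -> P b d -> P a d.
  move=> ab bd [z Cz hz] [w Cw hw].
  have [<-|ad] := eqVneq a d.
    by exists z => //; rewrite !subrr scale0r.
  have ad0 : 0 < d - a.
    by rewrite subr_gt0 lt_neqAle ad (le_trans ab bd).
  exists (((b - a) / (d - a)) *: z + ((d - b) / (d - a)) *: w).
    apply: convC => //.
    - by apply: divr_ge0; [rewrite subr_ge0|exact: ltW].
    - by apply: divr_ge0; [rewrite subr_ge0|exact: ltW].
    - by rewrite -mulrDl [b - a + _]addrC addrA subrK divff// gt_eqF.
  rewrite scalerDr !scalerA ![(d - a) * _]mulrC !divfK ?gt_eqF//.
  by rewrite -hz -hw [RHS]addrC addrA subrK.
have loc (s : R) : 0 <= s <= 1 -> exists2 e : R, 0 < e &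
    forall t : R, `|t| < e -> exists2 z, C z & c (s + t) - c s = t *: z.
  move=> /dc[L [linL cL [r r0 cr]] CL].
  have n1 := cr 1.
  have h : (fun t : R^o => (t, 1 : R^o)) @ nbhs (0 : R^o) --> ((0 : R^o), (1 :
    R^o)).
    by apply: nbhs_cvg_pair; [exact: cvg_id|exact: cvg_cst].
  have h1 : nbhs (0 : R^o) [set t | c (s + t *: 1) = c s + t *: (L 1 + r (t,
    1))].
    exact: h n1.
  have hz : (fun t : R^o => L 1 + r (t, 1)) @ nbhs (0 : R^o) --> L 1.
    rewrite -[X in _ --> X]addr0; apply: tlm_cvgD; first exact: cvg_cst.
    exact: (cvg_comp _ _ h (r0 1)).
  have h2 : nbhs (0 : R^o) [set t | C (L 1 + r (t, 1))].
    exact: hz (open_nbhs_nbhs (conj oC CL)).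
  have h3 : \forall t \near (0 : R), c (s + t *: (1 : R^o)) = c s + t *: (L 1 +
    r (t, 1))
      /\ C (L 1 + r (t, 1)) by exact: filterI h1 h2.
  have [e /= e0 he] := iffLR (nbhs_ballP _ _) h3.
  exists e => // t te; have [] := he t; first by rewrite -ball_normE /= sub0r
    normrN.
  move=> /= ht Ct; exists (L 1 + r (t, 1)) => //.
  have t1 : t *: (1 : R^o) = t by exact: mulr1.
  by rewrite -{1}t1 ht addrAC subrr add0r.
(* Continuous induction on the endpoints reached from 0: [loc] on the left of [sup S] puts it in
   [S], and on the right it would go past a supremum smaller than 1. *)
pose S := [set s : R | 0 <= s <= 1 /\ P 0 s].
have [z0 Cz0] : exists z, C z.
  by have [|L _ CL] := dc 0; [rewrite lexx ler01|exists (L 1)].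
have S0 : S 0 by split; [rewrite lexx ler01|exists z0 => //; rewrite !subrr
  scale0r].
have ubS : ubound S 1 by move=> s [/andP[]].
have supS : has_sup S by split; [exists 0|exists 1].
have s0 : 0 <= sup S by apply: ub_le_sup => //; exists 1.
have s1 : sup S <= 1 by apply: ge_sup => //; exists 0.
have s01 : 0 <= sup S <= 1 by rewrite s0 s1.
have [e e0 he] := loc _ s01.
have Pl a : a <= sup S -> `|a - sup S| < e -> P a (sup S).
  move=> a_s /he[z Cz]; rewrite subrKC => hz; exists z => //.
  by rewrite -opprB hz -scaleNr opprB.
have Pr b : sup S <= b -> `|b - sup S| < e -> P (sup S) b.
  by move=> a_s /he[z Cz]; rewrite subrKC => hz; exists z.
have PS : P 0 (sup S).
  have [a Sa ea] := sup_adherent e0 supS; have [/andP[a0 a1] Pa] := Sa.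
  have a_s : a <= sup S by apply: ub_le_sup => //; exists 1.
  apply: (Pcat _ a) => //; apply: Pl => //.
  by rewrite ler0_norm ?subr_le0// opprB ltrBlDr addrC -ltrBlDr.
have [s_1|s_1] := ltP (sup S) 1; last first.
  have [z Cz] := PS; have -> : sup S = 1 by apply/eqP; rewrite eq_le s1 s_1.
  by rewrite subr0 scale1r => ->.
pose b := Num.min (sup S + e / 2) 1.
have sb : sup S < b by rewrite lt_min s_1 ltrDl divr_gt0.
have be : `|b - sup S| < e.
  rewrite ger0_norm ?subr_ge0 ?ltW// ltrBlDl gt_min ltrD2l.
  by rewrite ltr_pdivrMr// ltr_pMr// ltr1n.
have : S b.
  split; first by rewrite (le_trans s0 (ltW sb)) ge_min lexx orbT.
  by apply: Pcat PS _ => //; [exact: ltW|apply: Pr => //; exact: ltW].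
move=> Sb; have : b <= sup S by apply: ub_le_sup => //; exists 1.
by rewrite leNgt sb.
Qed.

End MeanValue.

(** * From jointly smooth maps to operator-valued smooth maps *)

Section Currying.
Context {R : realType}.

Lemma lder_lin_at {E : tvsType R} {G : preTopologicalLmodType R}
    (f : E -> G) x L : is_lder f x L -> linear L.
Proof. by case. Qed.

Lemma lder_fst {E' E G : tvsType R} (g : E' * E -> G) x v L :
  is_lder g (x, v) L -> is_lder (fun y => g (y, v)) x (fun h => L (h, 0)).
Proof.
move=> gL; apply: (lder_comp (f := fun y => (y, v)) (L := fun h => (h, 0)) _
  gL).
apply: lder_pair; last exact: lder_cst.
by apply: lder_lin => // y; exact: cvg_id.
Qed.

Lemma lderD {E G : tvsType R} (f g : E -> G) x L M a :
  is_lder f x L -> is_lder g x M ->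
  is_lder (fun y => a *: f y + g y) x (fun h => a *: L h + M h).
Proof.
move=> fL gM.
apply: (@lder_comp _ _ (tprod G G) _ (fun y => (f y, g y))
  (fun q => a *: q.1 + q.2) x (fun h => (L h, M h)) (fun q => a *: q.1 + q.2)
  (lder_pair fL gM)).
apply: lder_lin.
  move=> b [u v] [u' v'] /=; rewrite !scalerDr !scalerA mulrC -!addrA.
  by congr (_ + _); rewrite addrCA.
move=> [u v]; apply: tlm_cvgD; last exact: nbhs_cvg_snd.
by apply: tlm_cvgZ; [exact: cvg_cst|exact: nbhs_cvg_fst].
Qed.

Lemma lder_line {E : tvsType R} (x k : E) (s : R^o) :
  is_lder (fun s : R^o => x + s *: k) s (fun t => t *: k).
Proof.
split.
- by move=> a t t'; rewrite scalerDl scalerA.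
- by move=> t; apply: tlm_cvgZ; [exact: cvg_id|exact: cvg_cst].
exists (fun=> 0) => w; first exact: cvg_cst.
by apply: filterE => -[t t'] /=; rewrite addr0 scalerDl scalerA addrA.
Qed.

Lemma near_shrink {E : tvsType R} (B : set E) (V : set E) : vbounded B ->
  nbhs 0 V -> exists2 t : R, 0 < t & forall x, B x -> V (t *: x).
Proof.
move=> bB V0; have /nbhs_ballP[e /= e0 he] := bB V V0.
exists (e / 2); first by rewrite divr_gt0.
apply: he; rewrite -ball_normE /= sub0r normrN gtr0_norm ?divr_gt0//.
by rewrite ltr_pdivrMr// ltr_pMr// ltr1n.
Qed.

Section Curry.
Context {E' E G : tvsType R} {sG : separated_tlm G}.
Variables (U : set E') (g : E' * E -> G) (gh : E' -> clin E G).
Hypotheses (oU : open U) (Cg : class_C 1 (U `*` [set: E]) g)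
  (ghE : forall x v, U x -> gh x v = g (x, v)).

(** The partial derivative in the base variable, the candidate for the derivative of [gh] at [x] in
    direction [h], evaluated at [v]. *)
Let g1 (x h : E') (v : E) : G := Df g (x, v) (h, 0).

Let g_lder x v : U x -> is_lder g (x, v) (Df g (x, v)).
Proof. by move=> Ux; apply: (class_C_diff Cg); split. Qed.

(** The identity [g(y, a v + w) = a g(y, v) + g(y, w)] holds for [y] near [x]; differentiating it in
    [y] and uniqueness give the result. *)
Lemma curry_D_linr x h : U x -> linear (g1 x h).
Proof.
move=> Ux a v w.
suff : (fun k => Df g (x, a *: v + w) (k, 0)) =
       (fun k => a *: Df g (x, v) (k, 0) + Df g (x, w) (k, 0)).
  by move=> /(congr1 (@^~ h)).
apply: lder_unique (lder_fst (g_lder _ Ux)) _.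
apply: lder_ext (lderD a (lder_fst (g_lder v Ux)) (lder_fst (g_lder w Ux))).
apply: filterS (open_nbhs_nbhs (conj oU Ux)) => y Uy.
by rewrite -!ghE// (clin_lin (gh y)).
Qed.

Lemma curry_D_linl x v : U x -> linear (fun h => g1 x h v).
Proof.
move=> Ux a h k; rewrite /g1.
have := lder_lin_at (g_lder v Ux) a (h, 0) (k, 0).
by rewrite -[a *: (h, 0) + _]/(a *: h + k, a *: 0 + 0) scaler0 addr0.
Qed.

Lemma curry_D_cts x h v : U x ->
  (fun p : (E' * E') * E => g1 p.1.1 p.1.2 p.2) @ nbhs ((x, h), v) --> g1 x h v.
Proof.
move=> Ux; have /class_C_cts h1 := class_C_D Cg.
have /h1 /= h2 : ((U `*` [set: E]) `*` setT) ((x, v), (h, (0 : E))) by [].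
have c1 := @nbhs_cvg_fst _ _ ((x, h) : tprod E' E') v.
have c11 := cvg_comp _ _ c1 (@nbhs_cvg_fst _ _ x h).
have c12 := cvg_comp _ _ c1 (@nbhs_cvg_snd _ _ x h).
have c2 := @nbhs_cvg_snd _ _ ((x, h) : tprod E' E') v.
apply: (cvg_comp (fun p : (E' * E') * E => ((p.1.1, p.2), (p.1.2, (0 : E)))) _
  _ h2).
apply: (@nbhs_cvg_pair _ _ _ (tprod E' E) (tprod E' E)).
  exact: nbhs_cvg_pair.
by apply: nbhs_cvg_pair => //; exact: cvg_cst.
Qed.

Lemma curry_mean_value (C : set G) x h v : open C -> convex C ->
  (forall s : R, 0 <= s <= 1 -> U (x + s *: h) /\ C (g1 (x + s *: h) h v)) ->
  C (g (x + h, v) - g (x, v)).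
Proof.
move=> oC convC hC.
pose c (s : R^o) := g (x + s *: h, v).
have -> : g (x + h, v) - g (x, v) = c 1 - c 0.
  by rewrite /c scale1r scale0r addr0.
apply: mean_value_convex => // s /hC[Us Cs].
exists (fun t => g1 (x + s *: h) (t *: h) v); last by rewrite scale1r.
have := lder_fst (g_lder v Us).
apply: (lder_comp (f := fun s : R^o => x + s *: h) (L := fun t : R^o => t *:
  h)).
exact: lder_line.
Qed.

(* With [t B] inside a small neighbourhood, bilinearity gives
   [Dg(y, v)(h, 0) = Dg(y, t v)(h / t, 0)], which is small uniformly in
   [v] in [B] by joint continuity; the mean value theorem concludes. *)
Lemma curry_cts x : U x -> gh @ nbhs x --> gh x.
Proof.
move=> Ux; apply/cvg_clinP => B N bB N0.
have [C [oC C0 CN convC]] := convex_nbhs N0.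
have h0 : g1 x 0 0 = 0 by exact: (lin0 (curry_D_linl _ Ux)).
have /= := @curry_D_cts x 0 0 Ux C; rewrite h0.
move=> /(_ (open_nbhs_nbhs (conj oC C0))) [[A V] /= [[[X H] /= [X0 H0] XHA] V0]
  AVC].
have [t t0 tB] := near_shrink bB V0.
have U0 := open_nbhs_nbhs (conj oU Ux).
have c0 : (fun w : E' => x + w) @ nbhs (0 : E') --> x.
  rewrite -[X in _ --> X]addr0.
  by apply: tlm_cvgD; [exact: cvg_cst|exact: cvg_id].
have [W [oW W0 WX convW]] := convex_nbhs (c0 _ (filterI X0 U0)).
have cx : (fun y : E' => y - x) @ nbhs x --> (0 : E').
  rewrite -[X in _ --> X](subrr x).
  by apply: tlm_cvgB; [exact: cvg_id|exact: cvg_cst].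
have ct : (fun y : E' => t^-1 *: (y - x)) @ nbhs x --> (0 : E').
  rewrite -[X in _ --> X](scaler0 _ (t^-1)).
  by apply: tlm_cvgZ => //; exact: cvg_cst.
have near1 : nbhs x [set y | W (y - x)] by exact: cx (open_nbhs_nbhs (conj oW
  W0)).
have near2 : nbhs x [set y | H (t^-1 *: (y - x))] by exact: ct H0.
apply: filterS (filterI U0 (filterI near1 near2)) => y [Uy [Wy Hy]] v Bv.
rewrite !ghE//; apply: CN; rewrite -(subrKC x y).
apply: curry_mean_value => // s /andP[s0 s1].
(* [W] is convex and contains 0, so the whole segment from [x] to [y] stays where the bound on [g1]
   is available. *)
have Ws : W (s *: (y - x)).
  rewrite -[_ *: _]addr0 -(scaler0 _ (1 - s)).
  by apply: convW => //; rewrite ?subr_ge0// subrKC.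
have [Xs Us] := WX _ Ws; split => //.
have -> : g1 (x + s *: (y - x)) (y - x) v =
          g1 (x + s *: (y - x)) (t^-1 *: (y - x)) (t *: v).
  rewrite (linZ (curry_D_linl _ Us)) (linZ (curry_D_linr _ Us)).
  by rewrite scalerA mulVf ?scale1r// gt_eqF.
apply: (AVC ((x + s *: (y - x), t^-1 *: (y - x)), t *: v)); split => /=.
  exact: XHA.
exact: tB.
Qed.

End Curry.

(** For fixed [v], the remainder is [c 1 - c 0], where [c] has derivative
    [gh1(x + s t h, h) v - gh1(x, h) v]. By [curry_cts] applied to the partial derivative of [g],
    [gh1] is continuous for bounded convergence, so this is small uniformly in [v] in [B], and the
    mean value theorem applies. *)
Lemma curry_lder {E' E G : tvsType R} {sG : separated_tlm G} (U : set E')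
    (g : E' * E -> G) (gh : E' -> clin E G) (gh1 : E' * E' -> clin E G) x :
  open U -> class_C 1 (U `*` [set: E]) g ->
  (forall x v, U x -> gh x v = g (x, v)) ->
  class_C 1 ((U `*` [set: E']) `*` [set: E]) (fun q => Df g (q.1.1, q.2)
    (q.1.2, 0)) ->
  (forall x h v, U x -> gh1 (x, h) v = Df g (x, v) (h, 0)) ->
  U x -> is_lder gh x (fun h => gh1 (x, h)).
Proof.
move=> oU Cg ghE Cg1 gh1E Ux.
have oU1 := @openXT E' E' _ oU.
have cgh1 (h : E') : gh1 @ nbhs (x, h) --> gh1 (x, h).
  by apply: (curry_cts oU1 Cg1) => // -[y k] v [/= Uy _]; exact: gh1E.
split.
- move=> a h k; apply: clin_ext => v.
  by rewrite clin_addE clin_scaleE !gh1E// (curry_D_linl Cg v Ux).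
- move=> h; apply: (cvg_comp (fun h => (x, h)) gh1 _ (cgh1 h)).
  by apply: nbhs_cvg_pair; [exact: cvg_cst|exact: cvg_id].
pose r (p : R^o * E') : clin E G := if p.1 == 0 then 0 else
  p.1^-1 *: (gh (x + p.1 *: p.2) - gh x) - gh1 (x, p.2).
exists r => h0; last first.
  apply: filterE => -[t h]; rewrite /r /=.
  have [->|t0] := eqVneq t 0; first by rewrite !scale0r !addr0.
  by rewrite subrKC scalerA divff// scale1r subrKC.
apply/cvg_clinP => B N bB N0.
have [C [oC C0 CN convC]] := convex_nbhs N0.
have [N' N'0 N'C] : exists2 N', nbhs 0 N' & forall x y, N' x -> N' y -> C (x -
  y).
  have := @sub_continuous G (0, 0) C; rewrite /= subr0.
  move=> /(_ (open_nbhs_nbhs (conj oC C0)))[[N1 N2] /= [N10 N20] N12].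
  exists (N1 `&` N2); first exact: filterI.
  by move=> u v [u1 _] [_ v2]; exact: (N12 (u, v)).
have /cvg_clinP/(_ B N' bB N'0) [[Y H] /= [Y0 H0] YH] := cgh1 h0.
have U0 := open_nbhs_nbhs (conj oU Ux).
have [[T H'] /= [T0 H'0] TH] := @ray_cvg R E' x h0 _ (filterI Y0 U0).
have /nbhs_ballP[e /= e0 eT] := T0.
exists (ball (0 : R^o) e, H `&` H'); first by split; [exact: nbhsx_ballx|exact:
  filterI].
move=> [t h] [/= te [Hh H'h]] v Bv; apply: CN; rewrite -[X in C X]/(r (t, h) v
  - 0) subr0 /r /=.
have [//|t0] := eqVneq t 0.
have hs (s : R) : 0 <= s <= 1 -> Y (x + (s * t) *: h) /\ U (x + (s * t) *: h).
  move=> /andP[s0 s1]; apply: (TH (s * t, h)); split => //=; apply: eT.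
  move: te; rewrite -!ball_normE /= !sub0r !normrN normrM; apply: le_lt_trans.
  by rewrite ger0_norm// ler_piMl.
have Yx : Y x.
  have [|] := hs 0; first by rewrite lexx ler01.
  by rewrite mul0r scale0r addr0.
pose c (s : R^o) : G := t^-1 *: g (x + s *: (t *: h), v) + (- s) *: gh1 (x, h)
  v.
rewrite -[X in C X]/(t^-1 *: (gh (x + t *: h) v - gh x v) - gh1 (x, h) v).
have -> : t^-1 *: (gh (x + t *: h) v - gh x v) - gh1 (x, h) v = c 1 - c 0.
  have [|_ U1] := hs 1; first by rewrite lexx ler01.
  rewrite mul1r in U1.
  rewrite !ghE// /c !scale1r scaleN1r oppr0 !scale0r !addr0 scalerBr.
  by rewrite addrAC.
apply: mean_value_convex => // s s01.
have [Ys Us] := hs s s01; rewrite -scalerA in Ys Us.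
exists (fun b : R^o => t^-1 *: Df g (x + s *: (t *: h), v) (b *: (t *: h), 0) +
   (- b) *: gh1 (x, h) v).
  apply: lderD.
    have gl : is_lder g (x + s *: (t *: h), v) (Df g (x + s *: (t *: h), v)).
      by apply: (class_C_diff Cg); split.
    have := lder_fst gl.
    apply: (lder_comp (f := fun s : R^o => x + s *: (t *: h))
       (L := fun b : R^o => b *: (t *: h))).
    exact: lder_line.
  apply: lder_lin.
    by move=> a b b'; rewrite opprD scalerDl scalerA mulrN.
  move=> b; apply: tlm_cvgZ; last exact: cvg_cst.
  exact: (@opp_continuous (R^o : tvsType R)).
rewrite scale1r scaleN1r.
rewrite -(linZ (curry_D_linl Cg v Us)) -?gh1E//.
rewrite [t^-1 *: (t *: h)]scalerA mulVf// scale1r.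
(* Both operators are compared with [gh1 (x, h0)], the point at which continuity of [gh1] was
   used. *)
rewrite (_ : _ - _ = (gh1 (x + s *: (t *: h), h) v - gh1 (x, h0) v)
   - (gh1 (x, h) v - gh1 (x, h0) v)); last first.
  by rewrite opprB addrA subrK.
by apply: N'C; [apply: (YH (_, _))|apply: (YH (_, _))].
Qed.

(** The derivative of [gh] is itself a curried map, that of [Dg(x, v)(h, 0)] over the base [U * E'].
    Currying loses one order of differentiability, hence a smooth [g] for every [n]. *)
Lemma class_C_curry n {E' E G : tvsType R} {sE' : separated_tlm E'}
    {sE : separated_tlm E} {sG : separated_tlm G} (U : set E')
    (g : E' * E -> G) (gh : E' -> clin E G) :
  open U -> smooth (U `*` [set: E]) g ->
  (forall x v, U x -> gh x v = g (x, v)) -> class_C n U gh.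
Proof.
elim: n E' sE' U g gh => [|n IH] E' sE' U g gh oU Cg ghE.
  by split=> // x Ux; exact: (curry_cts oU (Cg 1%N) ghE).
have oUE := @openXT E' E _ oU; have oUE' := @openXT E' E' _ oU.
have oUEE := @openXT _ (tprod E' E) _ oUE.
have oUE'E := @openXT _ E _ oUE'.
have Cg1 : smooth ((U `*` [set: E']) `*` [set: E])
    (fun q => Df g (q.1.1, q.2) (q.1.2, 0)).
  move=> k; apply: (@class_C_comp _ _ _ (tprod (tprod E' E) (tprod E' E)) _ _ _
    _ _
    ((U `*` [set: E]) `*` setT) (fun q => ((q.1.1, q.2), (q.1.2, 0)))
    (fun z : (E' * E) * (E' * E) => Df g z.1 z.2)) => //.
  - apply: class_C_pair => //; first by proj_C.
    apply: class_C_pair => //; first by proj_C.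
    exact: class_C_cst.
  - exact: class_C_D.
have /choice[gh1 gh1P] : forall p : E' * E', exists l : clin E G,
    U p.1 -> forall v, l v = Df g (p.1, v) (p.2, 0).
  (* Off [U] the operator is set to 0: linearity and continuity of the partial derivative in [v] are
     known over [U] only. *)
  move=> [y h]; have [Uy|] := pselect (U y); last by exists 0.
  have [l lE] : exists l : clin E G, forall v, l v = Df g (y, v) (h, 0).
    apply: mk_clin; first exact: (curry_D_linr oU (Cg 1%N) ghE h Uy).
    move=> v; have c := curry_D_cts (Cg 1%N) (h := h) (v := v) Uy.
    apply: (cvg_comp (fun v => ((y, h), v)) _ _ c).
    by apply: (@nbhs_cvg_pair _ _ _ (tprod E' E')); [exact: cvg_cst|exact:
      cvg_id].
  by exists l.
apply: (@class_C_S _ _ _ _ _ _ _ gh1) => //.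
- by move=> x Ux; exact: (curry_cts oU (Cg 1%N) ghE).
- move=> x Ux; apply: (curry_lder oU (Cg 1%N) ghE (Cg1 1%N)) => // y h v Uy.
  exact: (gh1P (y, h)).
apply: IH Cg1 _ => //.
by move=> [y h] v [/= Uy _]; exact: (gh1P (y, h)).
Qed.

End Currying.

(** * Charts, transition maps and the tangent manifold *)

Section Atlases.
Context {R : realType} {E : tvsType R}.
Implicit Types M : atlas E.

(** Isolated from [is_manifold], since [in_chartE] serves for [tangent M] and [T2 M] while these are
    being shown to be manifolds. *)
Definition charts_injective M : Prop := forall a x y,
  dom M a x -> dom M a y -> coord M a x = coord M a y -> x = y.

Lemma in_chartE M (a : chart M) {G : preTopologicalLmodType R}
    (g : pt M -> G) x :
  charts_injective M -> dom M a x -> in_chart a g (coord M a x) = g x.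
Proof.
move=> injM ax; rewrite /in_chart; case: xgetP => [_ -> [y [ay /injM ->]]//|].
by move=> /(_ (g x)); case; exists x.
Qed.

(** Trades the choice made by [in_chart] for an explicit formula [phi] in coordinates. *)
Lemma smooth_in_chart M (a : chart M) {G : preTopologicalLmodType R}
    (g : pt M -> G) (A : set (pt M)) (phi : E -> G) :
  charts_injective M -> A `<=` dom M a ->
  (forall x, A x -> g x = phi (coord M a x)) -> open (coord M a @` A) ->
  smooth (coord M a @` A) phi -> smooth (coord M a @` A) (in_chart a g).
Proof.
move=> injM Aa gphi oA Cphi n; apply: class_C_ext (Cphi n) => // _ [x Ax <-].
by rewrite in_chartE ?gphi//; exact: Aa.
Qed.

End Atlases.

Section Transitions.
Context {R : realType} {E : tvsType R} {sE : separated_tlm E} {M : atlas E}.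
Hypothesis manM : is_manifold M.
Implicit Types a b c : chart M.

Definition overlap a b : set E := coord M a @` (dom M a `&` dom M b).

Lemma manifold_inj : charts_injective M.
Proof. by case: manM => _ [_ []]. Qed.

Lemma dom_carrier a x : dom M a x -> carrier M x.
Proof. by case: manM => h _; exact: h. Qed.

Lemma overlap_open a b : open (overlap a b).
Proof. by case: manM => _ [_ [_ h]]; case: (h a b). Qed.

Lemma transition_smooth a b : smooth (overlap a b) (transition a b).
Proof. by case: manM => _ [_ [_ h]]; case: (h a b). Qed.

Lemma overlapP a b x : dom M a x -> overlap a b (coord M a x) <-> dom M b x.
Proof.
move=> ax; split=> [[y [ay b_y] /(manifold_inj ay ax) <-]//|bx].
by exists x.
Qed.

Lemma image_coordI a (A B : set (pt M)) :
  A `<=` dom M a -> B `<=` dom M a ->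
  coord M a @` (A `&` B) = (coord M a @` A) `&` (coord M a @` B).
Proof.
move=> Aa Ba; apply/seteqP; split=> [_ [x [Ax Bx] <-]|y [[x Ax <-] [z Bz]]].
  by split; exists x.
move=> /(manifold_inj (Ba _ Bz) (Aa _ Ax)) zx.
by exists x => //; split => //; rewrite -zx.
Qed.

Lemma transitionE a b x : dom M a x -> transition a b (coord M a x) = coord M b
  x.
Proof. by move=> ax; rewrite /transition in_chartE//; exact: manifold_inj. Qed.

Lemma transition_lder a b x : dom M a x -> dom M b x ->
  is_lder (transition a b) (coord M a x) (Df (transition a b) (coord M a x)).
Proof.
move=> ax bx; apply: (class_C_diff (@transition_smooth a b 1%N)).
exact/overlapP.
Qed.

Lemma overlap_nbhs a b x : dom M a x -> dom M b x ->
  nbhs (coord M a x) (overlap a b).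
Proof.
move=> ax bx; apply: open_nbhs_nbhs; split; first exact: overlap_open.
exact/overlapP.
Qed.

Lemma transition_cocycle a b c y : overlap a b y ->
  transition a c y = transition b c (transition a b y).
Proof. by move=> [x [ax bx] <-]; rewrite !transitionE. Qed.

Lemma D_transition_cocycle a b c x v :
  dom M a x -> dom M b x -> dom M c x ->
  Df (transition a c) (coord M a x) v =
  Df (transition b c) (coord M b x) (Df (transition a b) (coord M a x) v).
Proof.
move=> ax bx cx.
have bc := transition_lder bx cx; rewrite -(transitionE b ax) in bc *.
have := lder_comp (transition_lder ax bx) bc.
move=> h; rewrite (lder_Df (f := transition a c) _ (lder_ext _ h))//.
apply: filterS (overlap_nbhs ax bx) => y aby.
by rewrite /= -transition_cocycle.
Qed.

Lemma D_transition_id a x v : dom M a x ->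
  Df (transition a a) (coord M a x) v = v.
Proof.
move=> ax.
have h : is_lder (fun y : E => y) (coord M a x) (fun v => v).
  by apply: lder_lin => // y; exact: cvg_id.
rewrite (lder_Df _ (lder_ext _ h))//.
apply: filterS (overlap_nbhs ax ax) => _ [z [az _] <-].
by rewrite transitionE.
Qed.

(** The principal part [u] in [a] is spread to the other charts at [x] by the derivatives of the
    transition maps; compatibility is the cocycle identity. *)
Lemma tangent_mk a x u : dom M a x -> exists xi : pt (tangent M),
  [/\ dom (tangent M) a xi, xi.1 = x & coord (tangent M) a xi = (coord M a x,
    u)].
Proof.
move=> ax; pose xi : pt (tangent M) := (x, fun b => if `[< dom M b x >]
  then Df (transition a b) (coord M a x) u else 0).
have xiE b : dom M b x -> xi.2 b = Df (transition a b) (coord M a x) u.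
  by move=> bx; rewrite /xi /=; case: asboolP.
exists xi; split => //.
  split=> //; split=> [|b nb|b c bx cx].
  - exact: dom_carrier ax.
  - by rewrite /xi /=; case: asboolP.
  - by rewrite !xiE//; exact: D_transition_cocycle.
by rewrite -[LHS]/(coord M a x, xi.2 a) xiE// D_transition_id.
Qed.

Lemma image_tangent a (A : set (pt M)) : A `<=` dom M a ->
  coord (tangent M) a @` (dom (tangent M) a `&` [set xi | A xi.1]) =
  (coord M a @` A) `*` setT.
Proof.
move=> Aa; apply/seteqP; split=> [_ [xi [_ Axi] <-]|[_ u] [/= [x Ax <-] _]].
  by split => //=; exists xi.1.
have [xi [axi xi1 xiE]] := tangent_mk u (Aa _ Ax).
by exists xi => //; split => //=; rewrite xi1.
Qed.

Lemma tangent_overlap a b :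
  coord (tangent M) a @` (dom (tangent M) a `&` dom (tangent M) b) =
  overlap a b `*` setT.
Proof.
rewrite -image_tangent; last by move=> x [].
congr (_ @` _); apply/seteqP; split=> xi.
  by move=> [[txi axi] [_ bxi]].
by move=> [[txi axi] [_ bxi]].
Qed.

Lemma tangent_injective : charts_injective (tangent M).
Proof.
move=> a [x xi] [y eta] [[cx nx tx] /= ax] [[cy ny ty] /= ay] [exy exi].
have exy' := manifold_inj ax ay exy; subst y; congr (_, _).
apply/funext => b; have [bx|nbx] := pselect (dom M b x).
  by have /= -> := tx a b ax bx; have /= -> := ty a b ay bx; rewrite exi.
by have /= -> := nx b nbx; have /= -> := ny b nbx.
Qed.

Lemma tangent_transition a b p : (overlap a b `*` setT) p ->
  transition (M := tangent M) a b p =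
  (transition a b p.1, Df (transition a b) p.1 p.2).
Proof.
rewrite -tangent_overlap => -[[x xi] [axi [_ bxi]] <-].
rewrite {1}/transition in_chartE//; last exact: tangent_injective.
case: axi => -[_ _ tx] ax; rewrite /= transitionE//.
by have /= -> := tx a b ax bxi.
Qed.

Lemma tangent_manifold : is_manifold (tangent M).
Proof.
split=> [a xi []//|]; split.
  move=> xi [cxi n t]; case: manM => _ [+ _] => /(_ _ cxi)[a axi].
  by exists a; split.
split=> [|a b]; first exact: tangent_injective.
rewrite tangent_overlap; have oV := @openXT E E _ (overlap_open a b).
 split=> // n.
apply: (@class_C_ext _ n (tprod E E) (tprod E E) _ (fun p =>
  (transition (M := M) a b p.1, Df (transition (M := M) a b) p.1 p.2))) => //.
  by move=> p /tangent_transition.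
apply: class_C_pair => //; last exact: class_C_D (@transition_smooth a b n.+1).
apply: (@class_C_comp _ _ _ _ _ _ _ _ _ _ fst _ _ (overlap_open a b)) => //.
- by move=> p [].
- exact: class_C_fst.
- exact: transition_smooth.
Qed.

Lemma velocity_out {E' : tvsType R} {N : atlas E'} (f : R^o -> pt N) t (a :
  chart N) :
  ~ dom N a (f t) -> (velocity N f t).2 a = 0.
Proof. by rewrite /=; case: asboolP. Qed.

(** A pointwise condition, so that it applies both to a smooth curve in [M] and to its velocity
    curve in [tangent M]. *)
Definition curve_at_chart (f : R^o -> pt M) (t : R^o) : Prop := forall a,
  dom M a (f t) -> (\forall s \near t, dom M a (f s)) /\
  exists L, is_lder (coord M a \o f) t L.

Lemma velocity_tangent (f : R^o -> pt M) (t : R^o) :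
  carrier M (f t) -> curve_at_chart f t -> carrier (tangent M) (velocity M f t).
Proof.
move=> cft hf; split=> //= [a|a b ax bx]; first by case: asboolP.
case: asboolP => // _; case: asboolP => // _.
have [na [L hL]] := hf a ax.
rewrite (lder_Df _ hL).
have hab := transition_lder ax bx.
have := lder_comp (f := coord M a \o f) hL hab.
move=> h; rewrite (lder_Df _ (lder_ext _ h))//.
apply: filterS na => s as_.
by rewrite /= transitionE.
Qed.

Lemma smooth_curve_chart e (f : R^o -> pt M) (t : R^o) :
  smooth_curve M e f -> `|t| < e -> curve_at_chart f t.
Proof.
move=> [_ hf] te a aft; have [oV Vf] := hf a; split.
  by apply: filterS (open_nbhs_nbhs (conj oV (conj te aft))) => s [].
by eexists; apply: (class_C_diff (Vf 1%N)); split.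
Qed.

Lemma smooth_curve_velocity e (f : R^o -> pt M) (t : R^o) :
  smooth_curve M e f -> `|t| < e -> carrier (tangent M) (velocity M f t).
Proof.
move=> sf te; apply: velocity_tangent; first by case: sf => h _; exact: h.
exact: smooth_curve_chart sf te.
Qed.

Lemma velocity_near_lder e (f : R^o -> pt M) (t : R^o) a :
  smooth_curve M e f -> `|t| < e -> dom M a (f t) ->
  (\forall s \near t, dom (tangent M) a (velocity M f s)) /\
  is_lder (coord (tangent M) a \o velocity M f) t
    (fun v => (Df (coord M a \o f) t v,
               Df (fun s => Df (coord M a \o f) s 1) t v)).
Proof.
move=> sf te aft; have [_ /(_ a)[oV Vf]] := sf.
have nV := open_nbhs_nbhs (conj oV (conj te aft)); split.
  apply: filterS nV => s [se as_]; split => //.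
  exact: smooth_curve_velocity sf se.
have h1 := class_C_diff (Vf 1%N) (conj te aft).
have h2 : is_lder (fun s => Df (coord M a \o f) s 1) t
    (Df (fun s => Df (coord M a \o f) s 1) t).
  apply: lderDf; eexists; apply/leslieP.
  apply: (lder_fst (g := fun p => Df (coord M a \o f) p.1 p.2)).
  by apply: (class_C_diff (class_C_D (Vf 2%N))); split; first by split.
apply: lder_ext (lder_pair h1 h2).
apply: filterS nV => s [se as_].
by rewrite /=; case: asboolP.
Qed.

Lemma acceleration_chart e (f : R^o -> pt M) a :
  smooth_curve M e f -> 0 < e -> dom M a (f 0) ->
  (acceleration M f 0).2 a =
  (Df (coord M a \o f) 0 1, Df (fun s => Df (coord M a \o f) s 1) 0 1).
Proof.
move=> sf e0 af0; rewrite /acceleration /velocity /=.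
have ne : `|0 : R^o| < e by rewrite normr0.
have [nV hV] := velocity_near_lder sf ne af0.
case: asboolP => [_|[]]; last exact: nbhs_singleton nV.
by rewrite (lder_Df _ hV).
Qed.

End Transitions.

(** * The second order tangent bundle as a manifold *)

Section SecondOrder.
Context {R : realType} {E : tvsType R} {sE : separated_tlm E} {M : atlas E}.
Hypothesis manM : is_manifold M.
Implicit Types a b c : chart M.

Lemma acceleration_tangent e (f : R^o -> pt M) :
  smooth_curve M e f -> 0 < e ->
  carrier (tangent (tangent M)) (acceleration M f 0).
Proof.
move=> sf e0; have ne : `|0 : R^o| < e by rewrite normr0.
apply: (velocity_tangent (tangent_manifold manM)).
  exact: (smooth_curve_velocity manM sf ne).
move=> a [_ af0]; have [nV hV] := velocity_near_lder manM sf ne af0.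
by split => //; eexists; exact: hV.
Qed.

Lemma curves_at_carrier x (f : R^o -> pt M) : curves_at M x f -> carrier M x.
Proof.
by move=> [<- [e e0 [cf _]]]; apply: cf; rewrite /= normr0.
Qed.

Lemma velocity_acceleration x (f : R^o -> pt M) a : curves_at M x f ->
  dom M a x -> (velocity M f 0).2 a = ((acceleration M f 0).2 a).1.
Proof.
move=> [f0 [e e0 sf]] ax; rewrite (acceleration_chart manM sf e0); last by
  rewrite f0.
by rewrite /= f0; case: asboolP.
Qed.

Lemma acceleration_dom x (f : R^o -> pt M) a : curves_at M x f ->
  dom M a x -> dom (tangent (tangent M)) a (acceleration M f 0).
Proof.
move=> [f0 [e e0 sf]] ax; have cf := acceleration_tangent sf e0.
by split=> //; split; [case: cf|rewrite /= f0].
Qed.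

(* The action of a change of charts on [((psi f)'(0), (psi f)''(0))]: [f''(0)]
   is a vector at the point [f'(0)] of [TM], hence the repeated [uw.1]. *)
Definition second_transition a b (y : E) (uw : E * E) : E * E :=
  Df (transition (M := tangent M) a b) (y, uw.1) uw.

Lemma acceleration_transition x (f : R^o -> pt M) a b : curves_at M x f ->
  dom M a x -> dom M b x ->
  (acceleration M f 0).2 b =
    second_transition a b (coord M a x) ((acceleration M f 0).2 a).
Proof.
move=> cf ax bx.
have [[_ _ h] da] := acceleration_dom cf ax.
have [_ db] := acceleration_dom cf bx.
rewrite (h a b da db) /second_transition -(velocity_acceleration cf ax).
by rewrite -[in RHS](proj1 cf).
Qed.

(** One chart at [x] suffices: [second_transition] carries the principal part of [f''(0)] to every
    other chart at [x], its first component is [f'(0)], and in the remaining charts all parts are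
    0. *)
Lemma equiv2_acceleration x (f g : R^o -> pt M) a : curves_at M x f ->
  curves_at M x g -> dom M a x ->
  (acceleration M f 0).2 a = (acceleration M g 0).2 a -> equiv2 M f g.
Proof.
move=> cf cg ax eqa.
have eqb b : dom M b x -> (acceleration M f 0).2 b = (acceleration M g 0).2 b.
  move=> bx; apply: etrans (acceleration_transition cf ax bx) _.
  apply: etrans (esym (acceleration_transition cg ax bx)).
  exact: (congr1 (second_transition a b (coord M a x)) eqa).
have f0 : f 0 = x by case: cf.
have g0 : g 0 = x by case: cg.
have eqv : velocity M f 0 = velocity M g 0.
  apply: injective_projections => /=; first by rewrite f0.
  apply/funext => b; have [bx|nbx] := pselect (dom M b x).
    exact: (etrans (velocity_acceleration cf bx)
      (etrans (congr1 fst (eqb b bx)) (esym (velocity_acceleration cg bx)))).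
  by apply: etrans (velocity_out _) (esym (velocity_out _)); rewrite ?f0 ?g0.
split; first exact: eqv.
apply: injective_projections; first exact: eqv.
apply/funext => b; have [/eqb//|nbx] := pselect (dom M b x).
apply: etrans (velocity_out _) (esym (velocity_out _)).
  by rewrite /= f0 => -[].
by rewrite /= g0 => -[].
Qed.

Lemma equiv2_left (f g : R^o -> pt M) : equiv2 M f g ->
  forall h, equiv2 M f h <-> equiv2 M g h.
Proof.
rewrite /equiv2; move: (acceleration M f 0) (acceleration M g 0).
move: (velocity M f 0) (velocity M g 0) => v v' A A' [-> ->] h.
by [].
Qed.

Definition class2 x (f : R^o -> pt M) : pt (T2 M) :=
  (x, [set g | curves_at M x g /\ equiv2 M f g]).

Lemma class2_carrier x (f : R^o -> pt M) :
  curves_at M x f -> carrier (T2 M) (class2 x f).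
Proof. by move=> cf; split; [exact: curves_at_carrier cf|exists f]. Qed.

Lemma T2_class2 k : carrier (T2 M) k ->
  exists2 f, curves_at M k.1 f & k = class2 k.1 f.
Proof. by case: k => x C [/= cx [f cf ->]]; exists f. Qed.

Lemma coord_class2 x (f : R^o -> pt M) a : curves_at M x f ->
  coord (T2 M) a (class2 x f) = (coord M a x, (acceleration M f 0).2 a).
Proof.
move=> cf; congr (_, _); case: xgetP => [y -> [g [_ [_ eqa]] <-]|].
  exact: (congr1 (fun xi => xi.2 a) (esym eqa)).
by move=> /(_ ((acceleration M f 0).2 a)); case; exists f.
Qed.

Lemma T2_rep k : carrier (T2 M) k -> exists f, [/\ curves_at M k.1 f,
  k = class2 k.1 f &
  forall a, coord (T2 M) a k = (coord M a k.1, (acceleration M f 0).2 a)].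
Proof.
move=> /T2_class2[f cf kE]; exists f; split=> // a; rewrite {1}kE.
exact: coord_class2.
Qed.

Lemma T2_injective : charts_injective (T2 M).
Proof.
move=> a k k' [ck ak] [ck' ak'].
have [f [cf kE fE]] := T2_rep ck; have [g [cg k'E gE]] := T2_rep ck'.
move=> eqk; have eq1 : coord M a k.1 = coord M a k'.1 := congr1 fst eqk.
have xx' := manifold_inj manM ak ak' eq1; rewrite -{1}xx' in cg.
have eqa : (acceleration M f 0).2 a = (acceleration M g 0).2 a.
  exact: etrans (esym (congr1 snd (fE a)))
    (etrans (congr1 snd eqk) (congr1 snd (gE a))).
have eqfg := equiv2_acceleration cf cg ak eqa.
have h : class2 k.1 f = class2 k.1 g.
  apply: (congr1 (fun C => (k.1, C))).
  apply/seteqP; split=> h [ch eqh]; (split; first exact: ch).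
    exact: (equiv2_left eqfg h).1.
  exact: (equiv2_left eqfg h).2.
have h' := congr1 (fun x => class2 x g) xx'.
exact: etrans kE (etrans h (etrans h' (esym k'E))).
Qed.

Lemma T2_transition_coord k a b : carrier (T2 M) k -> dom M a k.1 ->
  dom M b k.1 -> coord (T2 M) b k =
    (transition a b (coord M a k.1),
     second_transition a b (coord M a k.1) (coord (T2 M) a k).2).
Proof.
move=> /T2_rep[f [cf _ fE]] ak bk.
apply: (etrans (fE b)); rewrite (transitionE manM b ak); congr (_, _).
apply: (etrans (acceleration_transition cf ak bk)).
exact: congr1 (esym (congr1 snd (fE a))).
Qed.

(** The parabola [y + t u + (t^2 / 2) w], with first and second derivatives [u] and [w] at 0,
    factored so that its smoothness follows from that of scalar multiplication. *)
Let path (y u w : E) (t : R^o) : E := y + t *: (u + (t / 2) *: w).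

Let path_add (y u w : E) (t h k : R) : path y u w (t + h * k) =
  path y u w t + h *: (k *: (u + t *: w) + h *: (k *: (k *: (2^-1 *: w)))).
Proof.
rewrite /path -[RHS]addrA; congr (_ + _).
rewrite !scalerDr !scalerA -!addrA [_ *: w + (_ *: u + _)]addrCA [RHS]addrA.
rewrite -!scalerDl; congr (_ *: _ + _ *: _); by field.
Qed.

Let path_lder y u w t : is_lder (path y u w) t (fun s => s *: (u + t *: w)).
Proof.
split.
- by move=> a s s'; rewrite scalerDl scalerA.
- by move=> s; apply: tlm_cvgZ; [exact: cvg_id|exact: cvg_cst].
exists (fun p : R^o * R^o => p.1 *: (p.2 *: (p.2 *: (2^-1 *: w)))) => v.
  rewrite -[X in _ --> X](scale0r (v *: (v *: (2^-1 *: w)))).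
  apply: tlm_cvgZ; first exact: nbhs_cvg_fst.
  apply: tlm_cvgZ; first exact: nbhs_cvg_snd.
  by apply: tlm_cvgZ; [exact: nbhs_cvg_snd|exact: cvg_cst].
by apply: filterE => -[h k]; exact: path_add.
Qed.

Let path_smooth y u w : smooth setT (path y u w).
Proof.
have sB n : class_C n setT (fun p : R^o * E => p.1 *: p.2).
  apply: class_C_bilin; last exact: scale_continuous.
  - by move=> t a v v' /=; rewrite scalerDr !scalerA mulrC.
  - by move=> v a t t' /=; rewrite scalerDl scalerA.
have oT := @openT R^o.
have mulC n (f : R^o -> E) : class_C n setT f ->
    class_C n setT (fun t : R^o => t *: f t).
  move=> Cf; apply: (@class_C_comp _ _ _ (tprod R^o E) _ _ _ _ _ setT
    (fun t => (t, f t)) (fun p => p.1 *: p.2)) => //; first exact: openT.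
  by apply: class_C_pair => //; exact: class_C_id.
move=> n; apply: (@class_CD _ _ _ _ _ _ _ (fun=> y)) => //; first exact:
  class_C_cst.
apply: (mulC n (fun t : R^o => u + (t / 2) *: w)).
apply: (@class_CD _ _ _ _ _ _ _ (fun=> u)) => //; first exact: class_C_cst.
rewrite (_ : (fun t : R^o => (t / 2) *: w) = (fun t : R^o => t *: (2^-1 *: w))).
  by apply: (mulC n (fun=> 2^-1 *: w)); exact: class_C_cst.
by apply/funext => t; rewrite scalerA.
Qed.

Lemma curve_ex x a u w : dom M a x -> exists2 f : R^o -> pt M,
  curves_at M x f & (acceleration M f 0).2 a = (u, w).
Proof.
move=> ax; set y := coord M a x; pose c := path y u w.
(* [overlap a a] is the image of the chart [a]. Where the parabola has left it, [f] takes an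
   arbitrary value; only times below [e] matter. *)
have /choice[f fc] : forall t : R^o, exists z, overlap a a (c t) ->
    dom M a z /\ coord M a z = c t.
  move=> t; have [[z [az _] zc]|nct] := pselect (overlap a a (c t)).
    by exists z.
  by exists x.
have c0 : c 0 = y by rewrite /c /path scale0r addr0.
have cc (t : R^o) : c @ nbhs t --> c t.
  exact: (class_C_cts (path_smooth y u w 0%N)).
have n0 : nbhs (0 : R^o) (c @^-1` overlap a a).
  by apply: cc; rewrite c0; exact: (overlap_nbhs manM).
have [e /= e0 he] := iffLR (@nbhs_ballP R R^o _ _) n0.
have fP (t : R^o) : `|t| < e -> dom M a (f t) /\ coord M a (f t) = c t.
  by move=> te; apply: fc; apply: he; rewrite -ball_normE /= sub0r normrN.
have ne : `|0 : R^o| < e by rewrite normr0.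
have f0 : f 0 = x.
  by have [af0 ef0] := fP _ ne; apply: (manifold_inj manM af0 ax); rewrite ef0
    c0.
have oI : open [set t : R^o | `|t| < e].
  rewrite (_ : [set t : R^o | `|t| < e] = ball (0 : R^o) e); first exact:
    ball_open.
  by rewrite -ball_normE; apply/seteqP; split=> t /=; rewrite sub0r normrN.
have VE b : [set t : R^o | `|t| < e] `&` f @^-1` dom M b =
    [set t : R^o | `|t| < e] `&` c @^-1` overlap a b.
  apply/seteqP; split=> t [te ft]; (split; first exact: te);
    have [aft eft] := fP t te.
    by have := (overlapP manM b aft).2 ft; rewrite eft.
  by apply: (overlapP manM b aft).1; rewrite eft.
have oV b : open ([set t : R^o | `|t| < e] `&` c @^-1` overlap a b).
  apply: openI => //; apply: open_comp; last exact: (overlap_open manM).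
  by move=> t _; exact: cc.
have sf : smooth_curve M e f.
  split=> [t te|b].
    by apply: (dom_carrier manM (a := a)); case: (fP t te).
  rewrite VE; split=> // n.
  apply: (@class_C_ext _ _ _ _ _ (fun t => transition a b (c t))) => //.
    by move=> t [te _]; have [aft <-] := fP t te; rewrite transitionE.
  apply: (class_C_comp (V := overlap a b)) => //.
  - exact: (overlap_open manM).
  - by move=> t [].
  - exact: class_C_sub (@subsetT _ _) (path_smooth y u w n).
  - exact: (transition_smooth manM).
exists f; first by split=> //; exists e.
have nI : nbhs (0 : R^o) [set t : R^o | `|t| < e].
  by apply: open_nbhs_nbhs; split.
have af0 : dom M a (f 0) by rewrite f0.
apply: (etrans (acceleration_chart manM sf e0 af0)).
have Dh (t : R^o) : `|t| < e -> is_lder (coord M a \o f) t (fun s => s *: (u +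
  t *: w)).
  move=> te; apply: lder_ext (path_lder y u w t).
  apply: filterS (open_nbhs_nbhs (conj oI te)) => s se /=.
  by rewrite (proj2 (fP s se)).
congr (_, _).
  by rewrite (lder_Df _ (Dh 0 ne)) scale0r addr0 scale1r.
have h : is_lder (fun s => Df (coord M a \o f) s 1) 0 (fun s => s *: w).
  apply: lder_ext (lder_line u w 0).
  by apply: filterS nI => s se; rewrite (lder_Df _ (Dh s se)) scale1r.
by rewrite (lder_Df _ h) scale1r.
Qed.

Lemma T2_surj x a u w : dom M a x -> exists k,
  [/\ dom (T2 M) a k, k.1 = x & coord (T2 M) a k = (coord M a x, (u, w))].
Proof.
move=> ax; have [f cf fE] := curve_ex u w ax; exists (class2 x f); split=> //.
  by split=> //; exact: class2_carrier.
by apply: (etrans (coord_class2 a cf)); congr (_, _).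
Qed.

(** Every pair [(u, w)] occurs over every point, so chart images in [T2 M] are full cylinders; this
    is the source of the openness statements on [T2 M]. *)
Lemma image_T2 a (A : set (pt M)) (B : set (pt (T2 M))) : A `<=` dom M a ->
  (forall k, dom (T2 M) a k -> (B k <-> A k.1)) ->
  coord (T2 M) a @` (dom (T2 M) a `&` B) = (coord M a @` A) `*` setT.
Proof.
move=> Aa BA; apply/seteqP; split=> [_ [k [dk Bk] <-]|[_ [u w]] [/= [x Ax <-]
  _]].
  by split=> //=; exists k.1 => //; apply/BA.
have [k [dk k1 kE]] := T2_surj u w (Aa _ Ax).
by exists k => //; split=> //; apply/(BA k dk); rewrite k1.
Qed.

Lemma T2_overlap a b :
  coord (T2 M) a @` (dom (T2 M) a `&` dom (T2 M) b) = overlap a b `*` setT.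
Proof.
apply: image_T2; first by move=> x [].
by move=> k [ck ak]; split=> [[_ bk]|[_ bk]]; split.
Qed.

Definition T2_transition a b (q : E * (E * E)) : E * (E * E) :=
  (transition a b q.1, second_transition a b q.1 q.2).

(** [second_transition] is the derivative of a transition map of [tangent M] precomposed with the
    linear map sending [(y, (u, w))] to [((y, u), (u, w))]. *)
Lemma T2_transition_smooth n a b :
  class_C n (E := tprod E (tprod E E)) (G := tprod E (tprod E E))
    (overlap a b `*` setT) (T2_transition a b).
Proof.
have oV := overlap_open manM a b; have oVT := @openXT _ (tprod E E) _ oV.
apply: class_C_pair => //.
  apply: (@class_C_comp _ _ _ _ _ _ _ _ _ _ fst _ _ oV) => //.
  - by move=> p [].
  - exact: class_C_fst.
  - exact: (transition_smooth manM).
have tm := tangent_manifold manM.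
have [_ [_ [_ /(_ a b)[_ CT]]]] := tm; rewrite (tangent_overlap manM a b) in CT.
apply: (@class_C_comp _ _ _ (tprod (tprod E E) (tprod E E)) _ _ _ _ _
  ((overlap a b `*` setT) `*` setT) (fun q => ((q.1, q.2.1), q.2))
  (fun p => Df (transition (M := tangent M) a b) p.1 p.2)) => //.
- by do 2!apply: openXT.
- by proj_C.
- exact: class_C_D (CT n.+1).
Qed.

Lemma T2_manifold : is_manifold (T2 M).
Proof.
split=> [a k []//|]; split.
  move=> k ck; case: manM => _ [+ _] => /(_ k.1 (proj1 ck))[a ak].
  by exists a; split.
split=> [|a b]; first exact: T2_injective.
have oV := @openXT _ (tprod E E) _ (overlap_open manM a b).
rewrite T2_overlap; split=> // n.
apply: (@class_C_ext _ n (tprod E (tprod E E)) (tprod E (tprod E E)) _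
  (T2_transition a b)) => //; last exact: T2_transition_smooth.
move=> q; rewrite -T2_overlap => -[k [dak dbk] <-].
rewrite /transition (in_chartE _ T2_injective dak).
by rewrite (T2_transition_coord (proj1 dak) (proj2 dak) (proj2 dbk)).
Qed.

End SecondOrder.

(** * Semiconjugate maps and the diagonal action of a derivative *)

Section DiagonalDerivative.
Context {R : realType}.

(** Both sides are derivatives of the same germ. With [L] a map [prj i] or [rho j i] and transition
    maps for [f1] and [f2], it turns compatible charts into compatible derivatives. *)
Lemma Df_semiconj {E1 E2 : tvsType R} {s2 : separated_tlm E2} (L : E1 -> E2)
    (f1 : E1 -> E1) (f2 : E2 -> E2) (y : E1) (v : E1) :
  linear L -> continuous L -> (\forall z \near y, L (f1 z) = f2 (L z)) ->
  is_lder f1 y (Df f1 y) -> is_lder f2 (L y) (Df f2 (L y)) ->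
  L (Df f1 y v) = Df f2 (L y) (L v).
Proof.
move=> linL cL ff h1 h2.
have l1 := lder_comp h1 (lder_lin (f1 y) linL cL).
have l2 := lder_comp (lder_lin y linL cL) h2.
exact: (congr1 (@^~ v) (lder_unique s2 (lder_ext ff l1) l2)).
Qed.

Definition Df2 {E : tvsType R} (f : E -> E) (y : E) : clin (tprod E E) (tprod E
  E) :=
  xget (0 : clin (tprod E E) (tprod E E))
    [set l : clin (tprod E E) (tprod E E) |
      forall z, l z = (Df f y z.1, Df f y z.2)].

Lemma Df2E {E : tvsType R} (f : E -> E) (y : E) z :
  is_lder f y (Df f y) -> Df2 f y z = (Df f y z.1, Df f y z.2).
Proof.
move=> [linf cf _]; rewrite /Df2; case: xgetP => [l -> //|nl].
have [l lE] : exists l : clin (tprod E E) (tprod E E),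
    forall z, l z = (Df f y z.1, Df f y z.2).
  apply: mk_clin; first by move=> a u v /=; rewrite !linf.
  move=> [u v]; apply: nbhs_cvg_pair.
    exact: (cvg_comp _ _ (@nbhs_cvg_fst _ _ u v) (cf u)).
  exact: (cvg_comp _ _ (@nbhs_cvg_snd _ _ u v) (cf v)).
by case: (nl l).
Qed.

(** The base map [k] separates the chart [a] in which smoothness is tested from the chart [c] where
    the derivative is taken: [k] will be [transition a c], followed by [prj i] for the component on
    [E i]. *)
Lemma class_C_Df2 n {E' E : tvsType R} {sE' : separated_tlm E'}
    {sE : separated_tlm E} (U : set E') (V : set E) (k : E' -> E) (f : E -> E) :
  open U -> open V -> (forall x, U x -> V (k x)) -> smooth U k -> smooth V f ->
  class_C n U (fun x => Df2 f (k x)).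
Proof.
move=> oU oV UV Ck Cf.
apply: (@class_C_curry _ _ _ (tprod E E) (tprod E E) _ _ _ U
  (fun p => (Df f (k p.1) p.2.1, Df f (k p.1) p.2.2))) => //.
  have oUT := @openXT _ (tprod E E) _ oU.
  have h m (g : E * E -> E) : class_C m (E := tprod E E) setT g ->
      class_C m (U `*` [set: E * E]) (fun p => Df f (k p.1) (g p.2)).
    move=> Cg; apply: (@class_C_comp _ _ (tprod E' (tprod E E)) (tprod E E) _ _
      _ _
      _ (V `*` setT) (fun p => (k p.1, g p.2)) (fun q => Df f q.1 q.2)) => //.
    - exact: openXT.
    - by move=> [x z] [/= /UV].
    - apply: class_C_pair => //.
        apply: (@class_C_comp _ _ _ _ _ _ _ _ _ _ fst _ _ oU) => //.
        + by move=> p [].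
        + exact: class_C_fst.
      apply: (@class_C_comp _ _ _ _ _ _ _ _ _ _ snd _ _ openT _ _ Cg) => //.
      exact: class_C_snd.
    - exact: class_C_D (Cf m.+1).
  move=> m; apply: class_C_pair => //; apply: h; [exact: class_C_fst|exact:
    class_C_snd].
move=> x z Ux; apply: Df2E; apply: (class_C_diff (Cf 1%N)); exact: UV.
Qed.

End DiagonalDerivative.

(** * Trivializations of [T2 M] defined by a connection *)

Section Trivialization.
Context {R : realType} {E : tvsType R} {sE : separated_tlm E}
  {cE : first_countable E} {M : atlas E}.
Hypothesis manM : is_manifold M.
Variables (D : pt (tangent (tangent M)) -> pt (tangent M))
  (omega : chart M -> E * E -> clin E E).
Hypothesis conD : is_connection M D omega.
Implicit Types a b c : chart M.

(** The value [s = 1] gives the trivialization and [s = - 1] its inverse: [u] is left alone and the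
    correction depends on [(y, u)] only. *)
Definition shear (s : R) b (q : E * (E * E)) : E * E :=
  (q.2.1, q.2.2 + s *: omega b (q.1, q.2.1) q.2.1).

Lemma shearK s b y z : shear s b (y, shear (- s) b (y, z)) = z.
Proof. by case: z => u v; rewrite /shear /= scaleNr subrK. Qed.

Lemma image_dom_open b : open (coord M b @` dom M b).
Proof. by have := overlap_open manM b b; rewrite /overlap setIid. Qed.

Lemma shear_smooth n s b : class_C n (E := tprod E (tprod E E)) (G := tprod E E)
  ((coord M b @` dom M b) `*` setT) (shear s b).
Proof.
have oO := image_dom_open b; have oT := @openXT _ (tprod E E) _ oO.
have oT' := @openXT _ E _ oO.
have [Cw _] := conD b.
apply: class_C_pair => //; first by proj_C.
apply: class_CD => //; first by proj_C.
apply: (@class_C_comp _ _ _ _ _ _ _ _ _ setT _ (fun v => s *: v) oT openT) =>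
  //.
  apply: (@class_C_comp _ _ _ (tprod (tprod E E) E) _ _ _ _ _
    (((coord M b @` dom M b) `*` setT) `*` setT)
    (fun q => ((q.1, q.2.1), q.2.1)) (fun p => omega b p.1 p.2)) => //.
  - exact: openXT.
  - by proj_C.
  (* First countability of [E] enters here, through evaluation of [omega b] at a moving vector. *)
  - exact: class_C_eval.
apply: class_C_lin.
  by move=> t u v; rewrite scalerDr !scalerA mulrC.
by move=> u; apply: tlm_cvgZ; [exact: cvg_cst|exact: cvg_id].
Qed.

(* By the local form of [D], this is the pair of the principal parts of [f'(0)]
   and [D (f''(0))] in the chart [b], for [k = [f, x]_2]. *)
Definition T2_fibre b (k : pt (T2 M)) : E * E := shear 1 b (coord (T2 M) b k).

Lemma connection_coord a xi : dom (tangent (tangent M)) a xi ->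
  dom (tangent M) a (D xi) /\ coord (tangent M) a (D xi) =
  (coord M a xi.1.1, (xi.2 a).2 + omega a (coord M a xi.1.1, xi.1.2 a) (xi.2
    a).1).
Proof.
move=> dxi; have [_ /(_ xi dxi)[dD]] := conD a.
by rewrite /=; case: (xi.2 a) => v w /= ->.
Qed.

Lemma T2_fibreE k f a : curves_at M k.1 f ->
  coord (T2 M) a k = (coord M a k.1, (acceleration M f 0).2 a) ->
  T2_fibre a k = (((acceleration M f 0).2 a).1, ((acceleration M f 0).2 a).2 +
   omega a (coord M a k.1, ((acceleration M f 0).2 a).1) ((acceleration M f
     0).2 a).1).
Proof. by move=> cf fE; rewrite /T2_fibre /shear fE scale1r. Qed.

Lemma T2_fibre_transition k b c : carrier (T2 M) k -> dom M b k.1 ->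
  dom M c k.1 -> T2_fibre b k =
    (Df (transition c b) (coord M c k.1) (T2_fibre c k).1,
     Df (transition c b) (coord M c k.1) (T2_fibre c k).2).
Proof.
move=> ck bk ck'; have [f [cf kE fE]] := T2_rep ck.
have f0 : f 0 = k.1 by case: cf.
have DP a : dom M a k.1 -> [/\ dom (tangent M) a (D (acceleration M f 0)),
    (D (acceleration M f 0)).1 = k.1 &
    (D (acceleration M f 0)).2 a = (T2_fibre a k).2].
  move=> ak; have [da coD] := connection_coord (acceleration_dom manM cf ak).
  split=> //.
    apply: (manifold_inj manM (proj2 da) ak).
    by apply: etrans (congr1 fst coD) _; rewrite -f0.
  apply: (etrans (congr1 snd coD)); rewrite (T2_fibreE cf (fE a)).
  rewrite -(velocity_acceleration manM cf ak) -f0.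
  by [].
have fib a : (T2_fibre a k).1 = ((acceleration M f 0).2 a).1.
  by rewrite (T2_fibreE cf (fE a)).
apply: injective_projections.
  have [_ [[_ _ tv] _]] := acceleration_dom manM cf ck'.
  have vE := tv c b; rewrite -[(acceleration M f 0).1]/(velocity M f 0) in vE.
  have := vE; rewrite -[(velocity M f 0).1]/(f 0) f0 => /(_ ck' bk) vbc.
  pose d := Df (transition c b) (coord M c k.1).
  have hc : d ((velocity M f 0).2 c) = d (T2_fibre c k).1.
    exact: (congr1 d (etrans (velocity_acceleration manM cf ck') (esym (fib
      c)))).
  have hb : (T2_fibre b k).1 = (velocity M f 0).2 b.
    exact: (etrans (fib b) (esym (velocity_acceleration manM cf bk))).
  exact: (etrans hb (etrans vbc hc)).
(* [D (f''(0))] is a point of [tangent M]; the compatibility of its principal parts [tD] is the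
   transformation law of the second component. *)
have [[[_ _ tD] _] Dc1 Dc2] := DP c ck'; have [_ _ Db2] := DP b bk.
have tDcb := tD c b; rewrite Dc1 in tDcb.
exact: (etrans (esym Db2)
  (etrans (tDcb ck' bk) (congr1 (Df (transition c b) (coord M c k.1)) Dc2))).
Qed.

Lemma image_overlap a b c :
  coord M a @` (dom M a `&` (dom M b `&` dom M c)) = overlap a b `&` overlap a
    c.
Proof.
rewrite -(image_coordI manM); [|by move=> x []..].
by rewrite setIACA setIid.
Qed.

Lemma overlap2_open a b c : open (overlap a b `&` overlap a c).
Proof. by apply: openI; exact: overlap_open. Qed.

Lemma transition_class_C n a c (U : set E) (G : tvsType R) {sG : separated_tlm
  G} :
  open U -> U `<=` overlap a c ->
  class_C n (U `*` [set: G]) (fun q => transition a c q.1).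
Proof.
move=> oU Uac; have oT := @openXT _ G _ oU.
apply: (@class_C_comp _ _ _ _ _ _ _ _ _ U fst (transition a c) oT oU) => //.
- by move=> q [].
- exact: class_C_fst.
- exact: (class_C_sub Uac (transition_smooth manM a c n)).
Qed.

Lemma transition_dom a b y : overlap a b y -> (coord M b @` dom M b)
  (transition a b y).
Proof. by move=> [x [ax bx] <-]; exists x => //; rewrite (transitionE manM).
  Qed.

Lemma transition_overlap a b c y : overlap a b y -> overlap a c y ->
  overlap b c (transition a b y).
Proof.
move=> [x [ax bx] <-] /(overlapP manM c ax) cx; rewrite (transitionE manM)//.
exact/(overlapP manM).
Qed.

Lemma T2_fibre_chart a b k : carrier (T2 M) k -> dom M a k.1 -> dom M b k.1 ->
  T2_fibre b k = shear 1 b (T2_transition a b (coord (T2 M) a k)).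
Proof.
by move=> ck ak bk; rewrite /T2_fibre (T2_transition_coord manM ck ak bk).
Qed.

Lemma prod_atlas_injective (G : tvsType R) : charts_injective (prod_atlas M G).
Proof.
move=> a [x u] [y v] [/= ax _] [/= ay _] [xy ->].
by rewrite (manifold_inj manM ax ay xy).
Qed.

Lemma T2_proj_smooth : msmooth (T2 M) M (carrier (T2 M)) (pi2 M).
Proof.
split=> [k []//|a b] /=; change (chart M) in a.
have -> : coord (T2 M) a @`
    (carrier (T2 M) `&` dom (T2 M) a `&` pi2 M @^-1` dom M b) = overlap a b `*` setT.
  rewrite -(image_T2 manM (B := carrier (T2 M) `&` pi2 M @^-1` dom M b)).
  - by congr (_ @` _); rewrite setIAC setIC.
  - by move=> x [].
  - by move=> k [ck ak]; split=> [[_ bk]|[_ bk]]; split.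
have oV := @openXT _ (tprod E E) _ (overlap_open manM a b).
split=> // n.
apply: (@class_C_ext _ n (tprod E (tprod E E)) E _
  (fun q => transition a b q.1)) => //; last first.
  exact: transition_class_C (overlap_open manM a b) (@subset_refl _ _).
move=> q; rewrite -(T2_overlap manM) => -[k [dak dbk] <-].
rewrite (in_chartE _ (T2_injective manM) dak)/=.
by rewrite (transitionE manM b (proj2 dak)).
Qed.

(** The charts [a] at the source and [c] at the target are arbitrary. Each map is carried from [a]
    to [b], sheared there, and read in [c], over the part of [a] that meets both [b] and [c]. *)
Lemma T2_trivialization b : is_trivialization M (T2 M) (pi2 M) (dom M b)
  (T2_fibre b).
Proof.
split.
  split=> [x|a]; first exact: (dom_carrier manM).
  by rewrite setIC; exact: (overlap_open manM).
have oT (G : tvsType R) (a c : chart M) := @openXT _ G _ (overlap2_open a b c).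
split.
  split=> [k [ck bk]|a c] /=; first by split=> //; exact: (dom_carrier manM bk).
  change (chart M) in a, c; set V := coord (T2 M) a @` _.
  have VE : V = (overlap a b `&` overlap a c) `*` setT.
    rewrite -image_overlap -(image_T2 manM
      (B := (carrier (T2 M) `&` pi2 M @^-1` dom M b) `&`
        (fun k => (k.1, T2_fibre b k)) @^-1` (dom M c `*` setT))).
    - by rewrite /V; congr (_ @` _); rewrite setIAC setIC.
    - by move=> x [].
    - move=> k [ck ak]; split=> [[[_ bk] [ck' _]]|[_ [bk ck']]]; first by split.
      by split; split.
  rewrite VE; split=> [|n]; first exact: oT.
  apply: (@class_C_ext _ n (tprod E (tprod E E)) (tprod E (tprod E E)) _
    (fun q => (transition a c q.1, shear 1 b (T2_transition a b q)))) => //.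
  - exact: oT.
  - rewrite -VE => _ [k [[[ck bk] [_ ak]] [ck' _]] <-].
    rewrite (in_chartE _ (T2_injective manM)); last by split.
    rewrite -[RHS]/(coord M c k.1, T2_fibre b k) (T2_fibre_chart ck ak bk).
    by rewrite -(transitionE manM c ak).
  apply: class_C_pair; first exact: oT.
    by apply: transition_class_C; [exact: overlap2_open|move=> y []].
  apply: (@class_C_comp _ _ _ (tprod E (tprod E E)) (tprod E E) _ _ _ _
    ((coord M b @` dom M b) `*` setT) (T2_transition a b)) => //.
  - exact: oT.
  - by apply: openXT; exact: image_dom_open.
  - by move=> q [[aby _] _]; split=> //; exact: transition_dom aby.
  - apply: (class_C_sub _ (T2_transition_smooth manM n a b)).
    by move=> q [[aby _] _]; split.
  - exact: shear_smooth.
(* The inverse is defined by its coordinates in [b]; off [dom M b] its value is arbitrary. *)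
have /choice[s sP] : forall z : pt M * (E * E), exists k : pt (T2 M),
    dom M b z.1 -> [/\ dom (T2 M) b k, k.1 = z.1 & coord (T2 M) b k =
      (coord M b z.1, shear (- 1) b (coord M b z.1, z.2))].
  move=> [x z]; have [bx|nbx] := pselect (dom M b x); last by exists (x, set0).
  have [k [dk k1 kE]] := T2_surj manM (shear (- 1) b (coord M b x, z)).1
     (shear (- 1) b (coord M b x, z)).2 bx.
  by exists k.
have shK y z : shear (- 1) b (y, shear 1 b (y, z)) = z.
  by have := shearK (- 1) b y z; rewrite opprK.
exists s; split.
- split=> [z [bz _]|a c] /=; first by have [[]] := sP z bz.
  change (chart M) in a, c.
  set V := coord (prod_atlas M (tprod E E)) a @` _.
  have VE : V = (overlap a b `&` overlap a c) `*` setT.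
    rewrite -image_overlap; apply/seteqP; split=> [_ [z [[[bz _] [az _]] [cz
      cz']] <-]|].
      split=> //=; exists z.1 => //; split=> //; split=> //.
      by have [_ <- _] := sP z bz.
    move=> [y z] [[x [ax [bx cx]] xy] _]; exists (x, z); last exact: (congr1
      (pair^~ z) xy).
    split; first by split.
    by have [[cs _] s1 _] := sP (x, z) bx; split=> //=; rewrite s1.
  rewrite VE; split=> [|n]; first exact: oT.
  apply: (@class_C_ext _ n (tprod E (tprod E E)) (tprod E (tprod E E)) _
    (fun q => T2_transition b c (transition a b q.1,
      shear (- 1) b (transition a b q.1, q.2)))) => //.
  - exact: oT.
  - rewrite -VE => _ [z [[[bz _] [az _]] [cs cz]] <-].
    rewrite (in_chartE _ (@prod_atlas_injective _)); last by split.
    have [[_ bs] s1 sE'] := sP z bz.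
    rewrite -[RHS]/(coord (T2 M) c (s z)) (T2_transition_coord manM cs bs cz).
    rewrite sE' s1 -(transitionE manM b az).
    by [].
  apply: (@class_C_comp _ _ _ (tprod E (tprod E E)) (tprod E (tprod E E)) _ _ _
    _
    (overlap b c `*` setT) (fun q => (transition a b q.1,
      shear (- 1) b (transition a b q.1, q.2))) (T2_transition b c)) => //.
  - exact: oT.
  - by apply: openXT; exact: overlap_open.
  - by move=> q [[aby acy] _]; split=> //; exact: transition_overlap.
  - have Ct : class_C n ((overlap a b `&` overlap a c) `*` setT)
        (fun q : E * (E * E) => transition a b q.1).
      by apply: transition_class_C; [exact: overlap2_open|move=> y []].
    apply: class_C_pair => //; first exact: oT.
    apply: (@class_C_comp _ _ _ (tprod E (tprod E E)) (tprod E E) _ _ _ _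
      ((coord M b @` dom M b) `*` setT) (fun q => (transition a b q.1, q.2))
      (shear (- 1) b)) => //.
    + exact: oT.
    + by apply: openXT; exact: image_dom_open.
    + by move=> q [[aby _] _]; split=> //; exact: transition_dom aby.
    + by apply: class_C_pair => //; [exact: oT|exact: class_C_snd].
    + exact: shear_smooth.
  - exact: (T2_transition_smooth manM n b c).
- by move=> z bz; have [[cs _] s1 _] := sP z bz; split=> //=; rewrite /pi2 s1.
- move=> k [ck bk]; have [ds s1 sE'] := sP (k.1, T2_fibre b k) bk.
  apply: (T2_injective manM ds); first by split.
  rewrite sE' /T2_fibre; apply: etrans (congr1 (pair _) (shK _ _)) _.
  by [].
- move=> z bz; have [ds s1 sE'] := sP z bz.
  apply: injective_projections => //.
  by rewrite -[LHS]/(T2_fibre b (s z)) /T2_fibre sE' (shearK 1).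
Qed.

End Trivialization.

(** * Separation and countability of the limit model space *)

Section ProjectiveLimit.
Context {R : realType} {E : nat -> completeNormedModType R}
  {rho : forall j i, E j -> E i} {F : tvsType R} {prj : forall i, F -> E i}.
Hypothesis limF : is_proj_limit rho prj.

Lemma proj_limit_separated : separated_tlm F.
Proof.
case: limF => prjL [_ [injF _]] x h; apply: injF => i.
have [linp cp] := prjL i; rewrite (lin0 linp).
apply: (@separated_normed R (E i)) => U U0; apply: (h (prj i @^-1` U)).
by apply: (cp 0); rewrite (lin0 linp).
Qed.

Lemma proj_limit_first_countable : first_countable F.
Proof.
case: limF => prjL [_ [_ [_ basF]]] x.
pose e n : R := n.+1%:R^-1.
exists (fun n => [set y | forall i, (i < n.+1)%N -> ball (prj i x) (e n) (prj i
  y)]).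
split.
- move=> n; apply: (near_ltn (Q := fun i => [set y | ball (prj i x) (e n) (prj
    i y)])).
  by move=> i; apply: (prjL i).2; apply: nbhsx_ballx; rewrite invr_gt0.
- move=> n m nm y hy i ni.
  have emn : e m <= e n by rewrite /e lef_pV2 ?posrE// ler_nat.
  by apply: (le_ball emn); apply: hy; apply: leq_trans ni _.
- move=> P /basF[i [B /nbhs_ballP[r /= r0 rB] BP]].
  have [n _ ne] := near_infty_natSinv_lt (PosNum r0).
  (* The index must be at least [i], to control the factor [i], and at least [n], to make the radius
     smaller than [r]. *)
  exists (maxn i n) => y hy; apply: BP; apply: rB.
  apply: le_ball (hy i _); last by rewrite ltnS leq_maxl.
  apply/ltW; exact: ne (leq_maxr _ _).
Qed.

End ProjectiveLimit.

(** * Transition operators along the projective limit *)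

Section LimitBundle.
Context {R : realType} {E : nat -> completeNormedModType R}
  {rho : forall j i, E j -> E i} {F : tvsType R} {prj : forall i, F -> E i}
  {Ms : forall i, atlas (E i)} {phi : forall j i, pt (Ms j) -> pt (Ms i)}
  {M : atlas F} {p : forall i, pt M -> pt (Ms i)}.
Hypotheses (sysE : proj_system rho) (limF : is_proj_limit rho prj)
  (sysM : manifold_proj_system phi) (limM : is_manifold_limit rho phi prj p).

Let sF : separated_tlm F := proj_limit_separated limF.
#[local] Existing Instance sF.

Let manM : is_manifold M. Proof. by case: limM. Qed.
Let manMs i : is_manifold (Ms i). Proof. by case: sysM => h _ _ _; exact: h.
  Qed.

Lemma transition_prj (b c : chart M) (ab ac : forall i, chart (Ms i)) i x :
  (forall x, dom M b x -> dom (Ms i) (ab i) (p i x) /\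
    prj i (coord M b x) = coord (Ms i) (ab i) (p i x)) ->
  (forall x, dom M c x -> dom (Ms i) (ac i) (p i x) /\
    prj i (coord M c x) = coord (Ms i) (ac i) (p i x)) ->
  dom M b x -> dom M c x -> forall v,
  prj i (Df (transition c b) (coord M c x) v) =
  Df (transition (ac i) (ab i)) (coord (Ms i) (ac i) (p i x)) (prj i v).
Proof.
move=> hb hc bx cx v; have [linp cp] := limF.1 i.
have [bi bE] := hb x bx; have [ci cE] := hc x cx.
rewrite -cE; apply: Df_semiconj => //.
- apply: filterS (overlap_nbhs manM cx bx) => _ [z [cz bz] <-].
  have [bi' bE'] := hb z bz; have [ci' cE'] := hc z cz.
  by rewrite (transitionE manM b cz) bE' cE' (transitionE (manMs i) _ ci').
- exact: (transition_lder manM).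
- by rewrite cE; exact: (transition_lder (manMs i)).
Qed.

Lemma transition_rho (ab ac : forall i, chart (Ms i)) i j y : (i <= j)%N ->
  chart_proj_system rho phi ab -> chart_proj_system rho phi ac ->
  dom (Ms j) (ab j) y -> dom (Ms j) (ac j) y -> forall v,
  @rho j i (Df (transition (ac j) (ab j)) (coord (Ms j) (ac j) y) v) =
  Df (transition (ac i) (ab i)) (coord (Ms i) (ac i) (@phi j i y)) (@rho j i v).
Proof.
move=> ij sb sc bj cj v; have [linp cp] : linear (@rho j i) /\ continuous (@rho
  j i).
  by case: sysE => h _ _; exact: h.
have [bi bE] := sb i j y ij bj; have [ci cE] := sc i j y ij cj.
rewrite cE; apply: Df_semiconj => //.
- apply: filterS (overlap_nbhs (manMs j) cj bj) => _ [z [cz bz] <-].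
  have [bi' bE'] := sb i j z ij bz; have [ci' cE'] := sc i j z ij cz.
  by rewrite (transitionE (manMs j) _ cz) -bE' -cE' (transitionE (manMs i) _
    ci').
- exact: (transition_lder (manMs j)).
- by rewrite -cE; exact: (transition_lder (manMs i)).
Qed.

(** The inverse comes from the reversed transition map, by the chain rule. *)
Lemma Df2_invertible i a c y : dom (Ms i) a y -> dom (Ms i) c y ->
  invertible (Df2 (transition c a) (coord (Ms i) c y)).
Proof.
move=> ay cy; exists (Df2 (transition a c) (coord (Ms i) a y)).
have inv b d : dom (Ms i) b y -> dom (Ms i) d y ->
    cancel (Df2 (transition d b) (coord (Ms i) d y))
           (Df2 (transition b d) (coord (Ms i) b y)).
  move=> yb yd [u v]; rewrite !Df2E; [|exact: (transition_lder (manMs i))..].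
  by rewrite /= -!(D_transition_cocycle (manMs i) _ yd yb yd)
    !(D_transition_id (manMs i) _ yd).
by split; apply: inv.
Qed.

End LimitBundle.

Theorem theorem3p2 (R : realType)
  (E : nat -> completeNormedModType R) (rho : forall j i, E j -> E i)
  (F : tvsType R) (prj : forall i, F -> E i)
  (Ms : forall i, atlas (E i)) (phi : forall j i, pt (Ms j) -> pt (Ms i))
  (M : atlas F) (p : forall i, pt M -> pt (Ms i))
  (Ds : forall i, pt (tangent (tangent (Ms i))) -> pt (tangent (Ms i)))
  (D : pt (tangent (tangent M)) -> pt (tangent M)) :
  proj_system rho ->
  is_proj_limit rho prj ->
  manifold_proj_system phi ->
  is_manifold_limit rho phi prj p ->
  (forall i, is_linear_connection (Ms i) (Ds i)) ->
  is_linear_connection M D ->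
  connection_limit phi p Ds D ->
  is_vector_bundle_H0 rho prj M (T2 M) (pi2 M).
Proof.
move=> sysE limF sysM limM _ [omega conD _] _.
have sF := proj_limit_separated limF.
have cF := proj_limit_first_countable limF.
have manM : is_manifold M by case: limM.
have manMs i : is_manifold (Ms i) by case: sysM => h _ _ _; exact: h.
split; first exact: T2_manifold.
split; first exact: T2_proj_smooth.
exists (chart M), (dom M), (fun b => T2_fibre omega b); split.
- by case: manM => _ [+ _].
- by move=> b; exact: (T2_trivialization manM conD).
move=> b c; have [_ [_ [phip [_ [_ [_ chartM]]]]]] := limM.
have [ab [sb domb cob]] := chartM b; have [ac [sc domc coc]] := chartM c.
have hb i x : dom M b x -> dom (Ms i) (ab i) (p i x) /\
    prj i (coord M b x) = coord (Ms i) (ab i) (p i x).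
  by move=> bx; split; [move: bx; rewrite domb => -[_]; apply|exact: cob].
have hc i x : dom M c x -> dom (Ms i) (ac i) (p i x) /\
    prj i (coord M c x) = coord (Ms i) (ac i) (p i x).
  by move=> cx; split; [move: cx; rewrite domc => -[_]; apply|exact: coc].
(* The transition goes from [c] to [b] since the cocycle sends [Phi c] to [Phi b]; [ab] and [ac] are
   projective systems of charts with limits [b] and [c]. *)
exists (fun x i => Df2 (transition (ac i) (ab i)) (coord (Ms i) (ac i) (p i
  x))),
  (fun x => Df2 (transition c b) (coord M c x)).
have lderi i x : dom M b x -> dom M c x -> is_lder (transition (ac i) (ab i))
    (coord (Ms i) (ac i) (p i x))
    (Df (transition (ac i) (ab i)) (coord (Ms i) (ac i) (p i x))).
  move=> /hb-/(_ i)[bi _] /hc-/(_ i)[ci _].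
  exact: (transition_lder (manMs i)).
split.
- move=> x [bx cx]; split=> [i|i j z ij].
    apply: (Df2_invertible sysM); first by case: (hb i x bx).
    by case: (hc i x cx).
  rewrite !Df2E; [|exact: lderi..]; have pE := phip i j x ij (dom_carrier manM
    bx).
  by congr (_, _); rewrite (transition_rho sysE sysM ij sb sc) ?pE//;
    [case: (hb j x bx)|case: (hc j x cx)|case: (hb j x bx)|case: (hc j x cx)].
- move=> x [bx cx] i z; rewrite !Df2E; [|exact: lderi|exact: (transition_lder
    manM)].
  by congr (_, _); rewrite (transition_prj limF sysM limM (hb i) (hc i)).
- move=> xi cxi [bx cx]; rewrite Df2E; last exact: (transition_lder manM).
  exact: (T2_fibre_transition manM conD).
- move=> i a; have [linp cp] := limF.1 i; rewrite setIC.
  (* The coordinate of [p i x] in [ac i] is the image under [prj i] of the coordinate of [x] in [c],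
     which [transition a c] computes from the one in [a]. *)
  apply: (smooth_in_chart (phi := fun y => Df2 (transition (ac i) (ab i))
    (prj i (transition a c y)))).
  + exact: (manifold_inj manM).
  + by move=> x [].
  + move=> x [ax [bx cx]]; rewrite (transitionE manM c ax).
    by have [_ ->] := hc i x cx.
  + by rewrite (image_overlap manM); exact: overlap2_open.
  rewrite (image_overlap manM) => n.
  apply: (class_C_Df2 n (k := fun y => prj i (transition a c y))
    (overlap2_open manM a b c) (overlap_open (manMs i) (ac i) (ab i))).
  + move=> _ [[x [ax bx] <-] /(overlapP manM c ax) cx].
    have [bi _] := hb i x bx; have [ci cE] := hc i x cx.
    by rewrite (transitionE manM c ax) cE; apply/(overlapP (manMs i)).
  + move=> m; apply: (@class_C_comp _ _ _ _ _ _ _ _ _ setT (transition a c)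
      (prj i)
      (overlap2_open manM a b c) openT) => //.
      apply: (class_C_sub _ (transition_smooth manM a c m)).
      by move=> y [].
    exact: class_C_lin.
  + exact: (transition_smooth (manMs i)).
- move=> a; rewrite setIC.
  apply: (smooth_in_chart (phi := fun y => Df2 (transition c b) (transition a c
    y))).
  + exact: (manifold_inj manM).
  + by move=> x [].
  + by move=> x [ax [bx cx]]; rewrite (transitionE manM c ax).
  + by rewrite (image_overlap manM); exact: overlap2_open.
  rewrite (image_overlap manM) => n.
  apply: (class_C_Df2 n (k := transition a c)
    (overlap2_open manM a b c) (overlap_open manM c b)).
  + by move=> y [aby acy]; exact: (transition_overlap manM acy aby).
  + move=> m; apply: (class_C_sub _ (transition_smooth manM a c m)).
    by move=> y [].
  + exact: (transition_smooth manM).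
Qed.
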